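(* Let $0<\alpha\le\alpha_0=(13-3\sqrt{17})/4=0.15767\ldots$. Let $f\in\mathcal H_{(d)}$ and $x\in\mathbb C^{n+1}$ be nonzero with $\operatorname{rank}Df(x)|_{x^\perp}=n$ and \[\frac{D^{3/2}}{2}\mu(f,x)\beta_0(f,x)\le\alpha.\] Then there is a zero $\zeta\in\mathbb C^{n+1}$ of $f$ with $d_T(x,\zeta)\le\sigma(\alpha)\beta_0(f,x)$, where $\sigma(\alpha)=\frac14+\frac{1-\sqrt{(1+\alpha)^2-8\alpha}}{4\alpha}$. Furthermore, with $y=N_f(x)$, $d_R(y,\zeta)\le(\sigma(\alpha)-1)\beta_0(f,x)$. Moreover, if $\alpha\le0.049$, then $x$ is an approximate zero of $f$ with associated zero $\zeta$, and so is $y$.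
   Context: $n\ge2$, $(d)=(d_1,\dots,d_n)$, $D=\max_i d_i\ge2$. $\mathcal H_{(d)}$: systems of $n$ homogeneous complex polynomials in $n+1$ variables of degrees $d_i$ with the Bombieri–Weyl inner product $\langle f,g\rangle=\sum_i\sum_{|\alpha|=d_i}\frac{\alpha_0!\cdots\alpha_n!}{d_i!}f_{i,\alpha}\overline{g_{i,\alpha}}$. $x^\perp$ is the Hermitian orthogonal complement of $x$. $\mu(f,x)=\|f\|\,\|(Df(x)|_{x^\perp})^{-1}\mathrm{diag}(\sqrt{d_i}\|x\|^{d_i-1})\|$ (operator norm). $\beta_0(f,x)=\|x\|^{-1}\|(Df(x)|_{x^\perp})^{-1}f(x)\|$. $N_f(x)=x-(Df(x)|_{x^\perp})^{-1}f(x)$. $d_R(x,y)\in[0,\pi/2]$ with $\cos d_R=|\langle x,y\rangle|/(\|x\|\|y\|)$, $d_T=\tan d_R$. A nonzero $x$ is an approximate zero of $f$ with associated zero $\zeta$ ($f(\zeta)=0$) if $x_0=x$, $x_p=N_f(x_{p-1})$ are defined for all $p\ge1$ and $d_T(\zeta,x_p)\le(1/2)^{2^p-1}d_T(\zeta,x)$. *)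

(* Defs.v *)
From Stdlib Require Import Reals List Arith Factorial.
Import ListNotations.
Open Scope R_scope.

Definition C := (R * R)%type.
Definition C0 : C := (0, 0).
Definition C1 : C := (1, 0).
Definition RtoC (r : R) : C := (r, 0).
Definition Cadd (a b : C) : C := (fst a + fst b, snd a + snd b).
Definition Copp (a : C) : C := (- fst a, - snd a).
Definition Csub (a b : C) : C := Cadd a (Copp b).
Definition Cmul (a b : C) : C :=
  (fst a * fst b - snd a * snd b, fst a * snd b + snd a * fst b).
Definition Cconj (a : C) : C := (fst a, - snd a).
Definition Cnorm2 (a : C) : R := fst a * fst a + snd a * snd a.
Definition Cabs (a : C) : R := sqrt (Cnorm2 a).
Fixpoint Cpow (a : C) (k : nat) : C :=
  match k with O => C1 | S k' => Cmul a (Cpow a k') end.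

Fixpoint Csum_list (l : list C) : C :=
  match l with [] => C0 | a :: l' => Cadd a (Csum_list l') end.
Fixpoint Rsum_list (l : list R) : R :=
  match l with [] => 0 | a :: l' => a + Rsum_list l' end.
Definition Csum (m : nat) (F : nat -> C) : C := Csum_list (map F (seq 0 m)).
Definition Rsum (m : nat) (F : nat -> R) : R := Rsum_list (map F (seq 0 m)).

(** * Vectors of C^m: functions nat -> C, only coordinates 0..m-1 matter *)
Definition Cvec := nat -> C.
Definition inner (m : nat) (x y : Cvec) : C :=
  Csum m (fun j => Cmul (x j) (Cconj (y j))).
Definition vnorm (m : nat) (x : Cvec) : R := sqrt (Rsum m (fun j => Cnorm2 (x j))).
Definition vnonzero (m : nat) (x : Cvec) : Prop := exists j, (j < m)%nat /\ x j <> C0.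

Fixpoint mindices (N d : nat) : list (list nat) :=
  match N with
  | O => match d with O => [[]] | S _ => [] end
  | S N' => flat_map (fun k => map (cons k) (mindices N' (d - k))) (seq 0 (S d))
  end.

Fixpoint monom_from (k : nat) (a : list nat) (z : Cvec) : C :=
  match a with
  | [] => C1
  | e :: a' => Cmul (Cpow (z k) e) (monom_from (S k) a' z)
  end.
Definition monom (a : list nat) (z : Cvec) : C := monom_from 0 a z.

Fixpoint decr_at (j : nat) (a : list nat) : list nat :=
  match a, j with
  | [], _ => []
  | e :: a', O => pred e :: a'
  | e :: a', S j' => e :: decr_at j' a'
  end.

(** A homogeneous polynomial of degree d in N variables is given by its
    coefficients c alpha, for alpha in mindices N d (other values ignored). *)
Definition poly := list nat -> C.

Definition peval (N d : nat) (c : poly) (z : Cvec) : C :=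
  Csum_list (map (fun a => Cmul (c a) (monom a z)) (mindices N d)).

Definition pderiv (N d : nat) (c : poly) (j : nat) (z : Cvec) : C :=
  Csum_list (map (fun a => Cmul (c a)
                   (Cmul (RtoC (INR (nth j a O))) (monom (decr_at j a) z)))
                 (mindices N d)).

(** * Systems f = (f_0,...,f_{n-1}), f_i of degree d i, in n+1 variables *)
Definition system := nat -> poly.

Definition sys_eval (n : nat) (d : nat -> nat) (f : system) (z : Cvec) : Cvec :=
  fun i => peval (S n) (d i) (f i) z.

Definition Dsys (n : nat) (d : nat -> nat) (f : system) (x w : Cvec) : Cvec :=
  fun i => Csum (S n) (fun j => Cmul (pderiv (S n) (d i) (f i) j x) (w j)).

Definition sys_nonzero (n : nat) (d : nat -> nat) (f : system) : Prop :=
  exists i a, (i < n)%nat /\ In a (mindices (S n) (d i)) /\ f i a <> C0.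

Definition is_zero (n : nat) (d : nat -> nat) (f : system) (z : Cvec) : Prop :=
  forall i, (i < n)%nat -> sys_eval n d f z i = C0.

Definition mfact (a : list nat) : R := fold_right (fun e r => INR (fact e) * r) 1 a.
Definition BWnorm (n : nat) (d : nat -> nat) (f : system) : R :=
  sqrt (Rsum n (fun i =>
    Rsum_list (map (fun a => mfact a / INR (fact (d i)) * Cnorm2 (f i a))
                   (mindices (S n) (d i))))).

Definition Dmax (n : nat) (d : nat -> nat) : nat := fold_right Nat.max O (map d (seq 0 n)).

Definition orth (n : nat) (w x : Cvec) : Prop := inner (S n) w x = C0.

Definition Dsolves (n : nat) (d : nat -> nat) (f : system) (x v w : Cvec) : Prop :=
  orth n w x /\ forall i, (i < n)%nat -> Dsys n d f x w i = v i.

(** rank Df(x)|_{x^perp} = n, i.e. its image is all of C^n *)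
Definition rank_full (n : nat) (d : nat -> nat) (f : system) (x : Cvec) : Prop :=
  forall v : Cvec, exists w, Dsolves n d f x v w.

Definition diag_scale (n : nat) (d : nat -> nat) (x v : Cvec) : Cvec :=
  fun i => Cmul (RtoC (sqrt (INR (d i)) * vnorm (S n) x ^ (d i - 1))) (v i).

(** the set { ||(Df(x)|_{x^perp})^{-1} diag(...) v|| : ||v|| <= 1 } *)
Definition opnorm_set (n : nat) (d : nat -> nat) (f : system) (x : Cvec) (r : R) : Prop :=
  exists v w, vnorm n v <= 1 /\ Dsolves n d f x (diag_scale n d x v) w /\ r = vnorm (S n) w.

Definition is_mu (n : nat) (d : nat -> nat) (f : system) (x : Cvec) (m : R) : Prop :=
  exists op, is_lub (opnorm_set n d f x) op /\ m = BWnorm n d f * op.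

(** w = (Df(x)|_{x^perp})^{-1} f(x) ; then N_f(x) = x - w and
    beta_0(f,x) = ||w|| / ||x|| *)
Definition newton_corr (n : nat) (d : nat -> nat) (f : system) (x w : Cvec) : Prop :=
  Dsolves n d f x (sys_eval n d f x) w.

Definition beta0 (n : nat) (x w : Cvec) : R := vnorm (S n) w / vnorm (S n) x.

Definition newton_step (n : nat) (d : nat -> nat) (f : system) (x y : Cvec) : Prop :=
  vnonzero (S n) x /\ rank_full n d f x /\
  exists w, newton_corr n d f x w /\ forall j, (j <= n)%nat -> y j = Csub (x j) (w j).

Definition dR (n : nat) (x y : Cvec) : R :=
  acos (Cabs (inner (S n) x y) / (vnorm (S n) x * vnorm (S n) y)).

(** d_T(x,y) = tan d_R(x,y) <= r   (d_T is finite, i.e. d_R < pi/2) *)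
Definition dT_le (n : nat) (x y : Cvec) (r : R) : Prop :=
  dR n x y < PI / 2 /\ tan (dR n x y) <= r.

Definition approx_zero (n : nat) (d : nat -> nat) (f : system) (x zeta : Cvec) : Prop :=
  vnonzero (S n) x /\ vnonzero (S n) zeta /\ is_zero n d f zeta /\
  exists xs : nat -> Cvec,
    (forall j, (j <= n)%nat -> xs O j = x j) /\
    forall p, newton_step n d f (xs p) (xs (S p)) /\
              dT_le n zeta (xs p) ((1/2) ^ (2 ^ p - 1) * tan (dR n zeta x)).

Definition alpha0 : R := (13 - 3 * sqrt 17) / 4.
Definition sigma_alpha (a : R) : R := / 4 + (1 - sqrt ((1 + a) ^ 2 - 8 * a)) / (4 * a).

(* Main.v *)
From Stdlib Require Import Reals List Arith Factorial Lra Lia.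
From Stdlib Require Import Classical ClassicalEpsilon.
Require Import Defs.
Import ListNotations.
Open Scope R_scope.

(** Normalize [|x| = 1] and put [gamma = D^(3/2) mu / 2].  Each [f_i] is
    recovered from its contractions [(1/d) df_i/dz_j], whose squared Bombieri
    norms add up to that of [f_i]; induction on the degree through
    Cauchy-Schwarz then bounds values, first-order remainders and variations
    of derivatives of [f_i] by those of the scalar polynomial [(1 + t)^d].
    Since [mu sqrt D >= 1], these are dominated by Smale's majorant
    [beta + gamma t^2 / (1 - gamma t)], whose smaller fixed point is at most
    [sigma(alpha) beta].  Newton's iteration with the derivative frozen at [x]
    stays in the chart [x + x^perp] and is majorized by the iterates of that
    function, which yields the zero [zeta] and both distance estimates.

    For the approximate zeros, the lower bound of [Df(x)] on [x^perp] is moved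
    to [Df(z)] on [z^perp] for every [z] with [d_T(zeta, z) <= d_T(zeta, x)],
    using [Df(zeta) zeta = 0].  The second-order remainder at [z] then gives
    [d_T(zeta, N_f(z)) <= 4 gamma d_T(zeta, z)^2], and
    [4 gamma d_T(zeta, x) < 1/2] when [alpha <= 0.049]. *)

(* For existence the derivative is inverted only at [x], the one point where mu gives control. The
   first iterate with the derivative frozen there is still the Newton point, so the part of the
   majorizing sequence after its first step gives the factor sigma(alpha) - 1.

   The majorant originates in (1 + t)(1 - t/2)^2 <= 1, which bounds (1 + t)^k by (1 - k t/2)^(-2);
   integrating (1 - gamma t)^(-2) - 1 gives the gamma term. With a = gamma beta, a fixed point u
   beta satisfies 2 a u^2 - (1 + a) u + 1 = 0, and sigma(a) is the smaller root. The discriminant (1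
   + a)^2 - 8 a is positive below 3 - 2 sqrt 2, which exceeds alpha_0.

   Two obstacles remain. The complement on which Df is inverted turns with the point, so bounds at
   [x] do not transfer to another point by perturbing Df alone. And the second claim bounds an
   angle, although the chart yields only its sine; the length sqrt(1 + beta^2) of the Newton point
   in the chart pays for the excess of arc over sine. *)
Declare Scope cplx_scope.
Delimit Scope cplx_scope with X.
Notation "a + b" := (Cadd a b) : cplx_scope.
Notation "a - b" := (Csub a b) : cplx_scope.
Notation "a * b" := (Cmul a b) : cplx_scope.
Notation "- a" := (Copp a) : cplx_scope.

(** * Complex numbers *)

Lemma C_ring_theory : ring_theory C0 C1 Cadd Cmul Csub Copp (@eq C).
Proof.
  split; intros; repeat match goal with z : C |- _ => destruct z end;
    unfold C0, C1, Csub, Cadd, Cmul, Copp; cbn [fst snd]; f_equal; ring.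
Qed.

Add Ring C_ring : C_ring_theory.

Definition Cinv (a : C) : C := (fst a / Cnorm2 a, - snd a / Cnorm2 a).

Lemma Cnorm2_ge0 a : 0 <= Cnorm2 a.
Proof. unfold Cnorm2; nra. Qed.

Lemma Cnorm2_eq0 a : Cnorm2 a = 0 -> a = C0.
Proof.
  unfold Cnorm2, C0; destruct a as [p q]; cbn [fst snd]; intros H.
  assert (p = 0) by nra; assert (q = 0) by nra; now subst.
Qed.

Lemma Cnorm2_C0 : Cnorm2 C0 = 0.
Proof. unfold Cnorm2, C0; cbn [fst snd]; ring. Qed.

Lemma Cnorm2_mul a b : Cnorm2 (a * b)%X = Cnorm2 a * Cnorm2 b.
Proof. unfold Cnorm2, Cmul; cbn [fst snd]; ring. Qed.

Lemma Cnorm2_RtoC r : Cnorm2 (RtoC r) = r * r.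
Proof. unfold Cnorm2, RtoC; cbn [fst snd]; ring. Qed.

Lemma Cinv_r a : a <> C0 -> (a * Cinv a)%X = C1.
Proof.
  intros Ha.
  assert (Cnorm2 a <> 0) by (intros H; now apply Ha, Cnorm2_eq0).
  unfold Cmul, Cinv, C1; cbn [fst snd]; unfold Cnorm2 in *; f_equal; now field.
Qed.

Lemma RtoC_add r s : RtoC (r + s) = (RtoC r + RtoC s)%X.
Proof. unfold RtoC, Cadd; cbn [fst snd]; f_equal; ring. Qed.

Lemma RtoC_mul r s : RtoC (r * s) = (RtoC r * RtoC s)%X.
Proof. unfold RtoC, Cmul; cbn [fst snd]; f_equal; ring. Qed.

Lemma Cabs_ge0 a : 0 <= Cabs a.
Proof. apply sqrt_pos. Qed.

Lemma Cabs_sqr a : Cabs a * Cabs a = Cnorm2 a.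
Proof. apply sqrt_sqrt, Cnorm2_ge0. Qed.

Lemma Cabs_mul a b : Cabs (a * b)%X = Cabs a * Cabs b.
Proof.
  unfold Cabs; rewrite Cnorm2_mul; apply sqrt_mult; apply Cnorm2_ge0.
Qed.

Lemma Cabs_C0 : Cabs C0 = 0.
Proof. unfold Cabs; rewrite Cnorm2_C0; apply sqrt_0. Qed.

Lemma Cabs_C1 : Cabs C1 = 1.
Proof.
  unfold Cabs, Cnorm2, C1; cbn [fst snd].
  replace (1 * 1 + 0 * 0) with 1 by ring; apply sqrt_1.
Qed.

Lemma Cabs_RtoC r : Cabs (RtoC r) = Rabs r.
Proof. unfold Cabs; rewrite Cnorm2_RtoC; apply sqrt_Rsqr_abs. Qed.

Lemma Cabs_eq0 a : Cabs a = 0 -> a = C0.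
Proof. intros H; apply Cnorm2_eq0; rewrite <- Cabs_sqr, H; ring. Qed.

Lemma Cabs_gt0 a : a <> C0 -> 0 < Cabs a.
Proof.
  intros H; destruct (Cabs_ge0 a) as [|E]; [easy|].
  now destruct H; apply Cabs_eq0.
Qed.

Lemma Cabs_opp a : Cabs (- a)%X = Cabs a.
Proof. unfold Cabs, Cnorm2, Copp; cbn [fst snd]; f_equal; ring. Qed.

Lemma Cabs_conj a : Cabs (Cconj a) = Cabs a.
Proof. unfold Cabs, Cnorm2, Cconj; cbn [fst snd]; f_equal; ring. Qed.

Lemma fst_le_Cabs a : fst a <= Cabs a.
Proof.
  destruct (Rle_dec (fst a) 0) as [H|H]; [pose proof (Cabs_ge0 a); lra|].
  rewrite <- (sqrt_square (fst a)) by lra.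
  apply sqrt_le_1_alt; unfold Cnorm2; nra.
Qed.

Lemma Cabs_fst a : Rabs (fst a) <= Cabs a.
Proof.
  apply Rabs_le; split; [|apply fst_le_Cabs].
  pose proof (fst_le_Cabs (- a)%X) as H; rewrite Cabs_opp in H.
  unfold Copp in H; cbn [fst] in H; lra.
Qed.

Lemma Cabs_snd a : Rabs (snd a) <= Cabs a.
Proof.
  unfold Cabs, Cnorm2; rewrite <- sqrt_Rsqr_abs; unfold Rsqr.
  apply sqrt_le_1_alt; nra.
Qed.

Lemma le_of_sqr_le a b : 0 <= b -> a * a <= b * b -> a <= b.
Proof. intros; nra. Qed.

Lemma Cabs_triangle a b : Cabs (a + b)%X <= Cabs a + Cabs b.
Proof.
  pose proof (Cabs_ge0 a); pose proof (Cabs_ge0 b).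
  apply le_of_sqr_le; [lra|].
  assert (E : fst (a * Cconj b)%X <= Cabs a * Cabs b)
    by (rewrite <- (Cabs_conj b), <- Cabs_mul; apply fst_le_Cabs).
  pose proof (Cabs_sqr a); pose proof (Cabs_sqr b); pose proof (Cabs_sqr (a + b)%X).
  unfold Cmul, Cconj, Cnorm2, Cadd in *; cbn [fst snd] in *; nra.
Qed.

Lemma Cconj_add a b : Cconj (a + b)%X = (Cconj a + Cconj b)%X.
Proof. unfold Cconj, Cadd; cbn [fst snd]; f_equal; ring. Qed.

Lemma Cconj_mul a b : Cconj (a * b)%X = (Cconj a * Cconj b)%X.
Proof. unfold Cconj, Cmul; cbn [fst snd]; f_equal; ring. Qed.

Lemma Cmul_conj a : (a * Cconj a)%X = RtoC (Cnorm2 a).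
Proof. unfold Cmul, Cconj, RtoC, Cnorm2; cbn [fst snd]; f_equal; ring. Qed.

(** * Finite sums *)

Lemma Csum_list_app l l' :
  Csum_list (l ++ l') = (Csum_list l + Csum_list l')%X.
Proof. induction l as [|a l IH]; cbn; [ring|rewrite IH; ring]. Qed.

Lemma Rsum_list_app l l' : Rsum_list (l ++ l') = Rsum_list l + Rsum_list l'.
Proof. induction l as [|a l IH]; cbn; [ring|rewrite IH; ring]. Qed.

Lemma Csum_0 F : Csum 0 F = C0.
Proof. reflexivity. Qed.

Lemma Rsum_0 F : Rsum 0 F = 0.
Proof. reflexivity. Qed.

Lemma Csum_S m F : Csum (S m) F = (Csum m F + F m)%X.
Proof.
  unfold Csum; rewrite seq_S, map_app, Csum_list_app; cbn; ring.
Qed.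

Lemma Rsum_S m F : Rsum (S m) F = Rsum m F + F m.
Proof.
  unfold Rsum; rewrite seq_S, map_app, Rsum_list_app; cbn; ring.
Qed.

Lemma Csum_Sl m F : Csum (S m) F = (F O + Csum m (fun j => F (S j)))%X.
Proof. unfold Csum; cbn [seq map Csum_list]; now rewrite <- seq_shift, map_map. Qed.

Lemma Rsum_Sl m F : Rsum (S m) F = F O + Rsum m (fun j => F (S j)).
Proof. unfold Rsum; cbn [seq map Rsum_list]; now rewrite <- seq_shift, map_map. Qed.

Lemma Csum_ext m F G :
  (forall j, (j < m)%nat -> F j = G j) -> Csum m F = Csum m G.
Proof.
  induction m as [|m IH]; intros H; [reflexivity|].
  rewrite !Csum_S, IH, H; auto with arith.
Qed.

Lemma Rsum_ext m F G :
  (forall j, (j < m)%nat -> F j = G j) -> Rsum m F = Rsum m G.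
Proof.
  induction m as [|m IH]; intros H; [reflexivity|].
  rewrite !Rsum_S, IH, H; auto with arith.
Qed.

Lemma Csum_add m F G :
  Csum m (fun j => F j + G j)%X = (Csum m F + Csum m G)%X.
Proof.
  induction m as [|m IH]; [rewrite !Csum_0; ring|rewrite !Csum_S, IH; ring].
Qed.

Lemma Csum_scal m c F : Csum m (fun j => c * F j)%X = (c * Csum m F)%X.
Proof.
  induction m as [|m IH]; [rewrite !Csum_0; ring|rewrite !Csum_S, IH; ring].
Qed.

Lemma Csum_sub m F G :
  Csum m (fun j => F j - G j)%X = (Csum m F - Csum m G)%X.
Proof.
  induction m as [|m IH]; [rewrite !Csum_0; ring|rewrite !Csum_S, IH; ring].
Qed.

Lemma Csum_zero m F : (forall j, (j < m)%nat -> F j = C0) -> Csum m F = C0.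
Proof.
  induction m as [|m IH]; intros H; [reflexivity|].
  rewrite Csum_S, IH, H; auto with arith; ring.
Qed.

Lemma Csum_Rsum m F : Csum m (fun j => RtoC (F j)) = RtoC (Rsum m F).
Proof.
  induction m as [|m IH]; [reflexivity|].
  now rewrite Csum_S, Rsum_S, IH, RtoC_add.
Qed.

Lemma Csum_swap m k (F : nat -> nat -> C) :
  Csum m (fun i => Csum k (fun j => F i j)) =
  Csum k (fun j => Csum m (fun i => F i j)).
Proof.
  induction m as [|m IH].
  - rewrite Csum_0; symmetry; now apply Csum_zero.
  - rewrite Csum_S, IH, <- Csum_add; apply Csum_ext; intros j _.
    now rewrite Csum_S.
Qed.

Lemma Rsum_scal m c F : Rsum m (fun j => c * F j) = c * Rsum m F.
Proof.
  induction m as [|m IH]; [rewrite !Rsum_0; ring|rewrite !Rsum_S, IH; ring].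
Qed.

Lemma Rsum_le m F G :
  (forall j, (j < m)%nat -> F j <= G j) -> Rsum m F <= Rsum m G.
Proof.
  induction m as [|m IH]; intros H; [rewrite !Rsum_0; lra|].
  rewrite !Rsum_S; apply Rplus_le_compat; auto with arith.
Qed.

Lemma Rsum_ge0 m F : (forall j, (j < m)%nat -> 0 <= F j) -> 0 <= Rsum m F.
Proof.
  induction m as [|m IH]; intros H; [rewrite Rsum_0; lra|].
  rewrite Rsum_S; apply Rplus_le_le_0_compat; auto with arith.
Qed.

Lemma Rsum_term_le m F k :
  (forall j, (j < m)%nat -> 0 <= F j) -> (k < m)%nat -> F k <= Rsum m F.
Proof.
  induction m as [|m IH]; intros H Hk; [lia|].
  rewrite Rsum_S; destruct (Nat.eq_dec k m) as [->|].
  - pose proof (Rsum_ge0 m F (fun j Hj => H j (Nat.lt_lt_succ_r _ _ Hj))); lra.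
  - assert (F k <= Rsum m F) by (apply IH; [intros; apply H; lia|lia]).
    pose proof (H m (Nat.lt_succ_diag_r m)); lra.
Qed.

Lemma Csum_list_ext {A} (F G : A -> C) l :
  (forall a, In a l -> F a = G a) ->
  Csum_list (map F l) = Csum_list (map G l).
Proof. intros H; now rewrite (map_ext_in F G). Qed.

Lemma Csum_list_scal {A} c (F : A -> C) l :
  Csum_list (map (fun a => c * F a)%X l) = (c * Csum_list (map F l))%X.
Proof. induction l as [|a l IH]; cbn; [ring|rewrite IH; ring]. Qed.

Lemma Csum_list_Rsum {A} (F : A -> R) l :
  Csum_list (map (fun a => RtoC (F a)) l) = RtoC (Rsum_list (map F l)).
Proof.
  induction l as [|a l IH]; [reflexivity|].
  cbn [map Csum_list Rsum_list]; now rewrite IH, RtoC_add.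
Qed.

Lemma Csum_list_swap {A} m (F : nat -> A -> C) l :
  Csum m (fun j => Csum_list (map (F j) l)) =
  Csum_list (map (fun a => Csum m (fun j => F j a)) l).
Proof.
  induction l as [|a l IH]; cbn; [now apply Csum_zero|].
  now rewrite <- IH, <- Csum_add.
Qed.

(** * Hermitian geometry *)

Definition vadd (u v : Cvec) : Cvec := fun j => (u j + v j)%X.
Definition vsub (u v : Cvec) : Cvec := fun j => (u j - v j)%X.
Definition vscal (c : C) (u : Cvec) : Cvec := fun j => (c * u j)%X.

Lemma vnorm_ge0 m u : 0 <= vnorm m u.
Proof. apply sqrt_pos. Qed.

Lemma vnorm_sqr m u : vnorm m u * vnorm m u = Rsum m (fun j => Cnorm2 (u j)).
Proof. apply sqrt_sqrt, Rsum_ge0; intros; apply Cnorm2_ge0. Qed.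

Lemma vnorm_ext m u v :
  (forall j, (j < m)%nat -> u j = v j) -> vnorm m u = vnorm m v.
Proof.
  intros H; unfold vnorm; f_equal; apply Rsum_ext; intros j Hj; now rewrite H.
Qed.

Lemma inner_ext m u v u' v' :
  (forall j, (j < m)%nat -> u j = u' j) -> (forall j, (j < m)%nat -> v j = v' j) ->
  inner m u v = inner m u' v'.
Proof. intros H H'; apply Csum_ext; intros j Hj; now rewrite H, H'. Qed.

Lemma Cabs_le_vnorm m u j : (j < m)%nat -> Cabs (u j) <= vnorm m u.
Proof.
  intros Hj; apply sqrt_le_1_alt.
  apply (Rsum_term_le m (fun j => Cnorm2 (u j))); [intros; apply Cnorm2_ge0|easy].
Qed.

Lemma vnorm_eq0 m u : vnorm m u = 0 -> forall j, (j < m)%nat -> u j = C0.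
Proof.
  intros H j Hj; apply Cabs_eq0.
  pose proof (Cabs_le_vnorm m u j Hj); pose proof (Cabs_ge0 (u j)); lra.
Qed.

Lemma vnorm_gt0 m u : vnonzero m u -> 0 < vnorm m u.
Proof.
  intros (j & Hj & H); pose proof (Cabs_le_vnorm m u j Hj).
  pose proof (Cabs_gt0 _ H); lra.
Qed.

Lemma vnorm_zero m u : (forall j, (j < m)%nat -> u j = C0) -> vnorm m u = 0.
Proof.
  intros H; unfold vnorm; rewrite (Rsum_ext m _ (fun _ => 0 * 0)).
  - rewrite Rsum_scal, Rmult_0_l; apply sqrt_0.
  - intros j Hj; rewrite H, Cnorm2_C0 by easy; ring.
Qed.

Lemma vnonzero_of_vnorm m u : 0 < vnorm m u -> vnonzero m u.
Proof.
  intros H; apply NNPP; intros Hn; apply Rlt_not_eq in H; apply H.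
  symmetry; apply vnorm_zero; intros j Hj.
  apply NNPP; intros Hj'; apply Hn; now exists j.
Qed.

Lemma vnorm_scal m c u : vnorm m (vscal c u) = Cabs c * vnorm m u.
Proof.
  unfold vnorm, Cabs; rewrite <- sqrt_mult.
  - f_equal; rewrite <- Rsum_scal; apply Rsum_ext; intros; apply Cnorm2_mul.
  - apply Cnorm2_ge0.
  - apply Rsum_ge0; intros; apply Cnorm2_ge0.
Qed.

(** Cauchy-Schwarz in the plane for (sqrt A, a) and (sqrt B, b): the squares of the two sides differ
    by (b sqrt A - a sqrt B)^2. *)
Lemma sqrt_pair_le A B a b :
  0 <= A -> 0 <= B -> 0 <= a -> 0 <= b ->
  sqrt A * sqrt B + a * b <= sqrt (A + a * a) * sqrt (B + b * b).
Proof.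
  intros HA HB Ha Hb.
  pose proof (sqrt_sqrt A HA); pose proof (sqrt_sqrt B HB).
  pose proof (sqrt_sqrt (A + a * a) ltac:(nra)) as H1.
  pose proof (sqrt_sqrt (B + b * b) ltac:(nra)) as H2.
  pose proof (sqrt_pos A); pose proof (sqrt_pos B).
  pose proof (sqrt_pos (A + a * a)); pose proof (sqrt_pos (B + b * b)).
  apply le_of_sqr_le; [nra|].
  replace (_ * _ * (_ * _)) with
    ((sqrt (A + a * a) * sqrt (A + a * a)) * (sqrt (B + b * b) * sqrt (B + b * b)))
    by ring.
  rewrite H1, H2.
  pose proof (Rle_0_sqr (b * sqrt A - a * sqrt B)) as Hsq; unfold Rsqr in Hsq.
  replace (_ * _) with (sqrt A * sqrt A * (sqrt B * sqrt B)
    + 2 * (a * b) * (sqrt A * sqrt B) + a * a * (b * b)) by ring.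
  replace (_ * _) with (b * b * (sqrt A * sqrt A) + a * a * (sqrt B * sqrt B)
    - 2 * (a * b) * (sqrt A * sqrt B)) in Hsq by ring.
  rewrite H, H0 in *; lra.
Qed.

(** No conjugation, because contractions pair with plain coordinates; [Cabs_inner_le] recovers the
    Hermitian form. *)
Lemma Cauchy_Schwarz m (u g : Cvec) :
  Cabs (Csum m (fun j => u j * g j)%X) <= vnorm m u * vnorm m g.
Proof.
  induction m as [|m IH].
  - rewrite Csum_0, Cabs_C0; unfold vnorm; rewrite !Rsum_0, sqrt_0; lra.
  - rewrite Csum_S; eapply Rle_trans; [apply Cabs_triangle|].
    rewrite Cabs_mul; unfold vnorm in *; rewrite !Rsum_S, <- !Cabs_sqr.
    eapply Rle_trans; [apply Rplus_le_compat_r, IH|].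
    apply sqrt_pair_le; try apply Cabs_ge0;
      apply Rsum_ge0; intros; apply Cnorm2_ge0.
Qed.

Lemma Cabs_inner_le m u v : Cabs (inner m u v) <= vnorm m u * vnorm m v.
Proof.
  eapply Rle_trans; [apply (Cauchy_Schwarz m u (fun j => Cconj (v j)))|].
  apply Req_le; f_equal; unfold vnorm; f_equal; apply Rsum_ext; intros j _.
  rewrite <- !Cabs_sqr, Cabs_conj; reflexivity.
Qed.

Lemma inner_self m u : inner m u u = RtoC (vnorm m u * vnorm m u).
Proof.
  rewrite vnorm_sqr, <- Csum_Rsum; apply Csum_ext; intros; apply Cmul_conj.
Qed.

Lemma inner_add_l m u v w : inner m (vadd u v) w = (inner m u w + inner m v w)%X.
Proof. unfold inner; rewrite <- Csum_add; apply Csum_ext; intros; unfold vadd; ring. Qed.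

Lemma inner_sub_l m u v w : inner m (vsub u v) w = (inner m u w - inner m v w)%X.
Proof. unfold inner; rewrite <- Csum_sub; apply Csum_ext; intros; unfold vsub; ring. Qed.

Lemma inner_scal_l m c u w : inner m (vscal c u) w = (c * inner m u w)%X.
Proof. unfold inner; rewrite <- Csum_scal; apply Csum_ext; intros; unfold vscal; ring. Qed.

Lemma inner_conj m u v : inner m v u = Cconj (inner m u v).
Proof.
  unfold inner; induction m as [|m IH].
  - rewrite !Csum_0; unfold Cconj, C0; cbn [fst snd]; f_equal; ring.
  - rewrite !Csum_S, Cconj_add, Cconj_mul, IH; f_equal.
    unfold Cmul, Cconj; cbn [fst snd]; f_equal; ring.
Qed.

Lemma inner_add_r m u v w : inner m w (vadd u v) = (inner m w u + inner m w v)%X.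
Proof.
  now rewrite inner_conj, inner_add_l, Cconj_add, <- !(inner_conj m _ w).
Qed.

Lemma inner_scal_r m c u w : inner m w (vscal c u) = (Cconj c * inner m w u)%X.
Proof.
  now rewrite inner_conj, inner_scal_l, Cconj_mul, <- !(inner_conj m _ w).
Qed.

Lemma vnorm_add_sqr m u v :
  vnorm m (vadd u v) * vnorm m (vadd u v) =
  vnorm m u * vnorm m u + 2 * fst (inner m u v) + vnorm m v * vnorm m v.
Proof.
  rewrite !vnorm_sqr; unfold inner, vadd; induction m as [|m IH].
  - unfold Rsum, Csum; cbn; ring.
  - rewrite !Rsum_S, Csum_S, IH; unfold Cnorm2, Cadd, Cmul, Cconj; cbn [fst snd]; ring.
Qed.

Lemma vnorm_triangle m u v : vnorm m (vadd u v) <= vnorm m u + vnorm m v.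
Proof.
  pose proof (vnorm_ge0 m u); pose proof (vnorm_ge0 m v).
  apply le_of_sqr_le; [lra|]; rewrite vnorm_add_sqr.
  pose proof (fst_le_Cabs (inner m u v)); pose proof (Cabs_inner_le m u v); nra.
Qed.

Lemma vnorm_sub_sym m u v : vnorm m (vsub u v) = vnorm m (vsub v u).
Proof.
  unfold vnorm; f_equal; apply Rsum_ext; intros j _.
  unfold vsub, Cnorm2, Csub, Cadd, Copp; cbn [fst snd]; ring.
Qed.

Lemma vnorm_sub_le m u v : vnorm m (vsub u v) <= vnorm m u + vnorm m v.
Proof.
  pose proof (vnorm_triangle m u (vscal (- C1)%X v)) as H.
  rewrite vnorm_scal, Cabs_opp in H.
  rewrite Cabs_C1, Rmult_1_l in H; eapply Rle_trans; [|apply H].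
  apply Req_le, vnorm_ext; intros; unfold vsub, vadd, vscal; ring.
Qed.

Lemma vnorm_le_add_sub m u v : vnorm m u <= vnorm m v + vnorm m (vsub u v).
Proof.
  eapply Rle_trans; [|apply vnorm_triangle].
  apply Req_le, vnorm_ext; intros; unfold vsub, vadd; ring.
Qed.

Lemma vnorm_sub_trans m u v w :
  vnorm m (vsub u w) <= vnorm m (vsub u v) + vnorm m (vsub v w).
Proof.
  eapply Rle_trans; [|apply vnorm_triangle].
  apply Req_le, vnorm_ext; intros; unfold vsub, vadd; ring.
Qed.

(** * Contractions of homogeneous polynomials *)

Fixpoint incr_at (j : nat) (a : list nat) : list nat :=
  match a, j with
  | [], _ => []
  | e :: a', O => S e :: a'
  | e :: a', S j' => e :: incr_at j' a'
  end.

(* Contraction of the symmetric tensor of c against the j-th basis vector, i.e.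
   the j-th partial derivative divided by the degree d. *)
Definition pcontr (d j : nat) (c : poly) : poly :=
  fun a => (RtoC (INR (S (nth j a O)) / INR d) * c (incr_at j a))%X.

Definition pnorm2 (N d : nat) (c : poly) : R :=
  Rsum_list (map (fun a => mfact a / INR (fact d) * Cnorm2 (c a)) (mindices N d)).

Definition pnorm (N d : nat) (c : poly) : R := sqrt (pnorm2 N d c).

Lemma decr_incr_at j a : (j < length a)%nat -> decr_at j (incr_at j a) = a.
Proof.
  revert j; induction a as [|e a IH]; intros [|j] H; cbn in *; try lia; try easy.
  now rewrite IH by lia.
Qed.

Lemma nth_incr_at_eq j a :
  (j < length a)%nat -> nth j (incr_at j a) O = S (nth j a O).
Proof.
  revert j; induction a as [|e a IH]; intros [|j] H; cbn in *; try lia; try easy.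
  apply IH; lia.
Qed.

Lemma nth_incr_at_neq j k a : j <> k -> nth j (incr_at k a) O = nth j a O.
Proof.
  revert j k; induction a as [|e a IH]; intros [|j] [|k] H; cbn in *; try easy.
  apply IH; lia.
Qed.

Lemma incr_at_comm j k a : incr_at j (incr_at k a) = incr_at k (incr_at j a).
Proof.
  revert j k; induction a as [|e a IH]; intros [|j] [|k]; cbn; try easy.
  now rewrite IH.
Qed.

Lemma monom_incr_at j a z :
  (j < length a)%nat -> monom (incr_at j a) z = (z j * monom a z)%X.
Proof.
  unfold monom; enough (G : forall k, (j < length a)%nat ->
    monom_from k (incr_at j a) z = (z (k + j)%nat * monom_from k a z)%X) by apply G.
  revert j; induction a as [|e a IH]; intros [|j] k H; cbn in *; try lia.
  - rewrite Nat.add_0_r; ring.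
  - rewrite IH by lia; replace (k + S j)%nat with (S k + j)%nat by lia.
    ring.
Qed.

Lemma mfact_incr_at j a :
  (j < length a)%nat -> mfact (incr_at j a) = INR (S (nth j a O)) * mfact a.
Proof.
  revert j; induction a as [|e a IH]; intros [|j] H;
    cbn [incr_at mfact fold_right nth length] in *; try lia.
  - rewrite fact_simpl, mult_INR; ring.
  - fold (mfact (incr_at j a)); fold (mfact a); rewrite IH by lia; ring.
Qed.

Lemma mindices_spec N d a :
  In a (mindices N d) -> length a = N /\ list_sum a = d.
Proof.
  revert d a; induction N as [|N IH]; intros d a H.
  - destruct d; cbn in H; [|easy]; destruct H as [<-|[]]; easy.
  - change (In a (flat_map (fun k => map (cons k) (mindices N (d - k))) (seq 0 (S d)))) in H.
    apply in_flat_map in H; destruct H as (k & Hk & H).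
    apply in_map_iff in H; destruct H as (b & <- & Hb).
    apply in_seq in Hk; destruct (IH _ _ Hb) as [E1 E2]; cbn.
    unfold list_sum in *; cbn; rewrite E2; lia.
Qed.

Lemma nth_le_list_sum j a : (nth j a O <= list_sum a)%nat.
Proof.
  revert j; induction a as [|e a IH]; intros [|j]; cbn; try lia.
  specialize (IH j); unfold list_sum in IH; lia.
Qed.

Lemma mindices_0 N : mindices N 0 = [repeat O N].
Proof. induction N as [|N IH]; [easy|]; cbn; rewrite IH; easy. Qed.

Lemma Csum_mindices_S N d (H : list nat -> C) :
  Csum_list (map H (mindices (S N) d)) =
  Csum (S d) (fun k => Csum_list (map (fun b => H (k :: b)) (mindices N (d - k)))).
Proof.
  change (mindices (S N) d) with
    (flat_map (fun k => map (cons k) (mindices N (d - k))) (seq 0 (S d))).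
  unfold Csum; induction (seq 0 (S d)) as [|k l IH]; [easy|].
  cbn [flat_map map Csum_list]; rewrite map_app, Csum_list_app, IH, map_map; easy.
Qed.

Lemma Csum_list_zero {A} (F : A -> C) l :
  (forall a, In a l -> F a = C0) -> Csum_list (map F l) = C0.
Proof.
  intros H; induction l as [|a l IH]; [easy|].
  cbn [map Csum_list]; rewrite H, IH by (intros; try apply H; now (left + right)); ring.
Qed.

(** [incr_at j] is a bijection from the indices of degree d onto those of degree d + 1 with positive
    j-th entry; the other indices contribute zero by hypothesis. *)
Lemma Csum_mindices_incr N d j (H : list nat -> C) :
  (j < N)%nat ->
  (forall a, In a (mindices N (S d)) -> nth j a O = O -> H a = C0) ->
  Csum_list (map (fun a => H (incr_at j a)) (mindices N d)) =
  Csum_list (map H (mindices N (S d))).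
Proof.
  revert d j H; induction N as [|N IH]; intros d j H Hj HH; [lia|].
  assert (HH' : forall k b, (k <= S d)%nat -> In b (mindices N (S d - k)) ->
    nth j (k :: b) O = O -> H (k :: b) = C0).
  { intros k b Hk Hb; apply HH.
    change (In (k :: b) (flat_map (fun k => map (cons k) (mindices N (S d - k)))
      (seq 0 (S (S d))))).
    apply in_flat_map; exists k; split; [apply in_seq; lia|now apply in_map]. }
  rewrite !Csum_mindices_S; destruct j as [|j].
  - rewrite (Csum_Sl (S d)), Csum_list_zero; [|intros b Hb; now apply HH'; [lia| |]].
    cbn [incr_at Nat.sub]; ring.
  (* A head equal to S d leaves a tail of degree 0, so its j-th entry vanishes: this block is the
     surplus on the right. *)
  - rewrite (Csum_S (S d)), Csum_list_zero with (l := mindices N (S d - S d)).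
    + match goal with |- _ = (?b + C0)%X => transitivity b; [|ring] end.
      apply Csum_ext; intros k Hk; replace (S d - k)%nat with (S (d - k)) by lia.
      apply (IH (d - k)%nat j (fun b => H (k :: b))); [lia|].
      intros b Hb Hb0; apply HH'; [lia| |easy].
      now replace (S d - k)%nat with (S (d - k)) by lia.
    + intros b Hb; apply HH'; [lia|easy|].
      rewrite Nat.sub_diag in Hb; apply mindices_spec in Hb as [_ Hb].
      pose proof (nth_le_list_sum j b); cbn; lia.
Qed.

Lemma RtoC_inj r s : RtoC r = RtoC s -> r = s.
Proof. now intros [=]. Qed.

Lemma Rsum_mindices_incr N d j (H : list nat -> R) :
  (j < N)%nat ->
  (forall a, In a (mindices N (S d)) -> nth j a O = O -> H a = 0) ->
  Rsum_list (map (fun a => H (incr_at j a)) (mindices N d)) =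
  Rsum_list (map H (mindices N (S d))).
Proof.
  intros Hj HH; apply RtoC_inj.
  rewrite <- (Csum_list_Rsum (fun a => H (incr_at j a))), <- Csum_list_Rsum.
  apply (Csum_mindices_incr N d j (fun a => RtoC (H a))); [easy|].
  intros a Ha Ha0; now rewrite HH.
Qed.

Lemma Rsum_nth a : Rsum (length a) (fun j => INR (nth j a O)) = INR (list_sum a).
Proof.
  induction a as [|e a IH]; [easy|].
  cbn [length]; rewrite Rsum_Sl; cbn [nth]; rewrite IH.
  change (list_sum (e :: a)) with (e + list_sum a)%nat; now rewrite plus_INR.
Qed.

Lemma mindices_weights N d a :
  In a (mindices N (S d)) -> Rsum N (fun j => INR (nth j a O) / INR (S d)) = 1.
Proof.
  intros Ha; apply mindices_spec in Ha as [El Es].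
  rewrite (Rsum_ext N _ (fun j => / INR (S d) * INR (nth j a O)))
    by (intros; unfold Rdiv; ring).
  rewrite Rsum_scal, <- El, Rsum_nth, Es.
  apply Rinv_l, not_0_INR; lia.
Qed.

(** Euler's identity divided by the degree: each monomial is split into shares a_j / (d + 1), which
    sum to 1. *)
Lemma peval_contr N d c z :
  peval N (S d) c z =
  Csum N (fun j => z j * peval N d (pcontr (S d) j c) z)%X.
Proof.
  unfold peval; symmetry.
  rewrite (Csum_ext N) with (G := fun j => Csum_list (map (fun a =>
    RtoC (INR (nth j a O) / INR (S d)) * (c a * monom a z))%X (mindices N (S d)))).
  - rewrite Csum_list_swap; apply Csum_list_ext; intros a Ha.
    rewrite (Csum_ext N) with
      (G := fun j => (c a * monom a z * RtoC (INR (nth j a O) / INR (S d)))%X)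
      by (intros; ring).
    rewrite Csum_scal, Csum_Rsum, mindices_weights by easy.
    change (RtoC 1) with C1; ring.
  - intros j Hj; rewrite <- Csum_list_scal, <- (Csum_mindices_incr N d j); [|easy|].
    + apply Csum_list_ext; intros a Ha; apply mindices_spec in Ha as [El Es].
      rewrite nth_incr_at_eq, monom_incr_at by lia; unfold pcontr; ring.
    + intros a _ ->; cbn [INR]; unfold Rdiv; rewrite Rmult_0_l.
      change (RtoC 0) with C0; ring.
Qed.

Lemma pderiv_contr N d c j z :
  (j < N)%nat ->
  pderiv N (S d) c j z = (RtoC (INR (S d)) * peval N d (pcontr (S d) j c) z)%X.
Proof.
  intros Hj; unfold pderiv, peval.
  rewrite <- Csum_list_scal, <- (Csum_mindices_incr N d j); [|easy|].
  - apply Csum_list_ext; intros a Ha; apply mindices_spec in Ha as [El Es].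
    rewrite nth_incr_at_eq, decr_incr_at by lia; unfold pcontr.
    replace (INR (S (nth j a O))) with (INR (S d) * (INR (S (nth j a O)) / INR (S d)))
      at 1 by (field; apply not_0_INR; lia).
    rewrite RtoC_mul; ring.
  - intros a _ ->; cbn [INR]; change (RtoC 0) with C0; ring.
Qed.

Lemma pderiv_0 N c j z : pderiv N 0 c j z = C0.
Proof.
  apply Csum_list_zero; intros a Ha; apply mindices_spec in Ha as [_ Es].
  pose proof (nth_le_list_sum j a); replace (nth j a O) with O by lia.
  cbn [INR]; change (RtoC 0) with C0; ring.
Qed.

Lemma Rsum_list_ext {A} (F G : A -> R) l :
  (forall a, In a l -> F a = G a) ->
  Rsum_list (map F l) = Rsum_list (map G l).
Proof. intros H; now rewrite (map_ext_in F G). Qed.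

Lemma Rsum_list_swap {A} m (F : nat -> A -> R) l :
  Rsum m (fun j => Rsum_list (map (F j) l)) =
  Rsum_list (map (fun a => Rsum m (fun j => F j a)) l).
Proof.
  apply RtoC_inj; rewrite <- Csum_Rsum, <- Csum_list_Rsum.
  rewrite (Csum_ext m) with
    (G := fun j => Csum_list (map (fun a => RtoC (F j a)) l))
    by (intros; now rewrite Csum_list_Rsum).
  rewrite Csum_list_swap; apply Csum_list_ext; intros; apply Csum_Rsum.
Qed.

(** The Bombieri weight of [incr_at j a] is (a_j + 1)/(d + 1) times that of [a]. A squared
    contraction carries this ratio twice: one copy accounts for the change of weight, the other is
    the share that sums to 1 over j. *)
Lemma pnorm2_contr N d c :
  pnorm2 N (S d) c = Rsum N (fun j => pnorm2 N d (pcontr (S d) j c)).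
Proof.
  unfold pnorm2; symmetry.
  rewrite (Rsum_ext N) with (G := fun j => Rsum_list (map (fun a =>
    INR (nth j a O) / INR (S d) * (mfact a / INR (fact (S d)) * Cnorm2 (c a)))
    (mindices N (S d)))).
  - rewrite Rsum_list_swap; apply Rsum_list_ext; intros a Ha.
    rewrite (Rsum_ext N) with (G := fun j =>
      mfact a / INR (fact (S d)) * Cnorm2 (c a) * (INR (nth j a O) / INR (S d)))
      by (intros; ring).
    rewrite Rsum_scal, mindices_weights by easy; ring.
  - intros j Hj; rewrite <- (Rsum_mindices_incr N d j); [|easy|].
    + apply Rsum_list_ext; intros a Ha; apply mindices_spec in Ha as [El Es].
      rewrite nth_incr_at_eq, mfact_incr_at by lia; unfold pcontr.
      rewrite Cnorm2_mul, Cnorm2_RtoC, fact_simpl, mult_INR.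
      field; split; apply not_0_INR; [apply fact_neq_0|lia].
    + intros a _ ->; cbn [INR]; unfold Rdiv; ring.
Qed.

Lemma pcontr_comm N d d' j k c z :
  (j < N)%nat -> (k < N)%nat ->
  peval N d (pcontr d' j (pcontr (S d') k c)) z =
  peval N d (pcontr d' k (pcontr (S d') j c)) z.
Proof.
  intros Hj Hk; apply Csum_list_ext; intros a Ha; apply mindices_spec in Ha as [El _].
  f_equal; unfold pcontr; destruct (Nat.eq_dec j k) as [->|E]; [easy|].
  rewrite !nth_incr_at_neq, (incr_at_comm j k) by lia; unfold Rdiv; rewrite !RtoC_mul; ring.
Qed.

Lemma Rsum_list_ge0 {A} (F : A -> R) l :
  (forall a, 0 <= F a) -> 0 <= Rsum_list (map F l).
Proof.
  intros H; induction l as [|a l IH]; cbn; [lra|]; specialize (H a); lra.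
Qed.

Lemma mfact_gt0 a : 0 < mfact a.
Proof.
  induction a as [|e a IH]; cbn [mfact fold_right]; [lra|].
  apply Rmult_lt_0_compat; [apply lt_0_INR, lt_O_fact|easy].
Qed.

Lemma pnorm2_ge0 N d c : 0 <= pnorm2 N d c.
Proof.
  apply Rsum_list_ge0; intros a; apply Rmult_le_pos; [|apply Cnorm2_ge0].
  apply Rlt_le, Rdiv_lt_0_compat; [apply mfact_gt0|apply lt_0_INR, lt_O_fact].
Qed.

Lemma pnorm_ge0 N d c : 0 <= pnorm N d c.
Proof. apply sqrt_pos. Qed.

Lemma pnorm_sqr N d c : pnorm N d c * pnorm N d c = pnorm2 N d c.
Proof. apply sqrt_sqrt, pnorm2_ge0. Qed.

(** The inductive step of all the bounds below: after Cauchy-Schwarz over j, [pnorm2_contr] collects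
    the norms of the contractions into the norm of [c]. *)
Lemma contr_bound N d c (u g : Cvec) B :
  0 <= B ->
  (forall j, (j < N)%nat -> Cabs (g j) <= pnorm N d (pcontr (S d) j c) * B) ->
  Cabs (Csum N (fun j => u j * g j)%X) <= pnorm N (S d) c * (vnorm N u * B).
Proof.
  intros HB H; eapply Rle_trans; [apply Cauchy_Schwarz|].
  pose proof (vnorm_ge0 N u); pose proof (pnorm_ge0 N (S d) c).
  replace (_ * (_ * B)) with (vnorm N u * (pnorm N (S d) c * B)) by ring.
  apply Rmult_le_compat_l; [easy|].
  apply le_of_sqr_le; [nra|].
  replace (_ * B * _) with (B * B * (pnorm N (S d) c * pnorm N (S d) c)) by ring.
  rewrite pnorm_sqr, pnorm2_contr, vnorm_sqr, <- Rsum_scal.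
  apply Rsum_le; intros j Hj; specialize (H j Hj).
  rewrite <- Cabs_sqr, <- pnorm_sqr; pose proof (Cabs_ge0 (g j)); nra.
Qed.

Lemma peval_0 N c z : peval N 0 c z = c (repeat O N).
Proof.
  unfold peval; rewrite mindices_0; cbn [map Csum_list].
  enough (E : forall k, monom_from k (repeat O N) z = C1)
    by (unfold monom; rewrite E; ring).
  induction N as [|N IH]; intros k; [easy|].
  cbn [repeat monom_from Cpow]; rewrite IH; ring.
Qed.

Lemma pnorm_0 N c : pnorm N 0 c = Cabs (c (repeat O N)).
Proof.
  unfold pnorm, pnorm2, Cabs; f_equal; rewrite mindices_0; cbn [map Rsum_list].
  assert (E : mfact (repeat O N) = 1).
  { induction N as [|N IH]; [easy|]; cbn [repeat mfact fold_right].
    fold (mfact (repeat O N)); rewrite IH; cbn; ring. }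
  rewrite E; cbn; field.
Qed.

Lemma peval_bound N d c z s :
  vnorm N z <= s -> Cabs (peval N d c z) <= pnorm N d c * s ^ d.
Proof.
  intros Hs; pose proof (vnorm_ge0 N z).
  revert c; induction d as [|d IH]; intros c.
  - rewrite peval_0, pnorm_0; cbn [pow]; lra.
  - rewrite peval_contr.
    assert (0 <= s ^ d) by (apply pow_le; lra).
    eapply Rle_trans; [apply (contr_bound N d c z); [|intros; apply IH]; easy|].
    apply Rmult_le_compat_l; [apply pnorm_ge0|].
    cbn [pow]; now apply Rmult_le_compat_r.
Qed.

Lemma pow_le_pow d s s' : 0 <= s' -> s' <= s -> s' ^ d <= s ^ d.
Proof. intros; apply pow_incr; lra. Qed.

(** Writing F_j for the contractions, z_j F_j(z) - z'_j F_j(z') is (z - z')_j F_j(z) + z'_j (F_j(z)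
    - F_j(z')), and the scalar model obeys the same recursion: s^(d+1) - s'^(d+1) = (s - s') s^d +
    s' (s^d - s'^d). *)
Lemma peval_lipschitz N d c z z' s s' :
  vnorm N z <= s -> vnorm N z' <= s' -> vnorm N (vsub z z') <= s - s' ->
  Cabs (peval N d c z - peval N d c z')%X <= pnorm N d c * (s ^ d - s' ^ d).
Proof.
  intros Hs Hs' Hd; pose proof (vnorm_ge0 N z').
  pose proof (vnorm_ge0 N (vsub z z')).
  revert c; induction d as [|d IH]; intros c.
  - rewrite !peval_0; unfold Rminus; cbn [pow].
    replace (_ - _)%X with C0 by ring; rewrite Cabs_C0; lra.
  - pose proof (pow_le_pow d s s' ltac:(lra) ltac:(lra)) as Hp.
    assert (0 <= s ^ d) by (apply pow_le; lra).
    rewrite !peval_contr.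
    transitivity (Cabs
      (Csum N (fun j => vsub z z' j * peval N d (pcontr (S d) j c) z) +
       Csum N (fun j => z' j * (peval N d (pcontr (S d) j c) z -
                                peval N d (pcontr (S d) j c) z')))%X).
    { apply Req_le; f_equal; rewrite <- Csum_add, <- Csum_sub.
      apply Csum_ext; intros; unfold vsub; ring. }
    eapply Rle_trans; [apply Cabs_triangle|].
    pose proof (contr_bound N d c (vsub z z')
      (fun j => peval N d (pcontr (S d) j c) z) (s ^ d) ltac:(lra)
      (fun j _ => peval_bound N d _ z s Hs)) as B1.
    pose proof (contr_bound N d c z' (fun j => peval N d (pcontr (S d) j c) z -
      peval N d (pcontr (S d) j c) z')%X (s ^ d - s' ^ d) ltac:(lra)
      (fun j _ => IH _)) as B2.
    eapply Rle_trans; [apply Rplus_le_compat; [apply B1|apply B2]|].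
    rewrite <- Rmult_plus_distr_l; apply Rmult_le_compat_l; [apply pnorm_ge0|].
    cbn [pow]; nra.
Qed.

(** * Differentials and Taylor remainders *)

Definition pdiff (N d : nat) (c : poly) (x u : Cvec) : C :=
  Csum N (fun j => pderiv N d c j x * u j)%X.

Lemma pdiff_0 N c x u : pdiff N 0 c x u = C0.
Proof. apply Csum_zero; intros; rewrite pderiv_0; ring. Qed.

Lemma pdiff_S N d c x u :
  pdiff N (S d) c x u =
  (RtoC (INR (S d)) * Csum N (fun j => u j * peval N d (pcontr (S d) j c) x))%X.
Proof.
  rewrite <- Csum_scal; apply Csum_ext; intros; rewrite pderiv_contr by easy; ring.
Qed.

(** Leibniz rule for [peval_contr]. The factor d + 1 of [pdiff_S] splits into 1 for the first sum
    and d for the second, where symmetry of second derivatives exchanges the two contractions. *)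
Lemma pdiff_contr N d c x u :
  pdiff N (S d) c x u =
  (Csum N (fun j => u j * peval N d (pcontr (S d) j c) x) +
   Csum N (fun j => x j * pdiff N d (pcontr (S d) j c) x u))%X.
Proof.
  rewrite pdiff_S; destruct d as [|d].
  - rewrite (Csum_zero N (fun j => x j * pdiff N 0 _ x u)%X)
      by (intros; rewrite pdiff_0; ring).
    cbn [INR]; change (RtoC 1) with C1; ring.
  - enough (E : Csum N (fun j => x j * pdiff N (S d) (pcontr (S (S d)) j c) x u)%X =
      (RtoC (INR (S d)) *
        Csum N (fun j => u j * peval N (S d) (pcontr (S (S d)) j c) x))%X)
      by (rewrite E, (S_INR (S d)), RtoC_add; change (RtoC 1) with C1; ring).
    rewrite <- Csum_scal.
    transitivity (Csum N (fun j => Csum N (fun k => RtoC (INR (S d)) * (x j * (u k *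
      peval N d (pcontr (S d) k (pcontr (S (S d)) j c)) x))))%X).
    { apply Csum_ext; intros; rewrite pdiff_S, !Csum_scal; ring. }
    rewrite Csum_swap; apply Csum_ext; intros k Hk.
    rewrite peval_contr, <- !Csum_scal; apply Csum_ext; intros j Hj.
    rewrite (pcontr_comm N d (S d) j k) by easy; ring.
Qed.

Lemma pdiff_euler N d c z :
  pdiff N d c z z = (RtoC (INR d) * peval N d c z)%X.
Proof.
  destruct d as [|d]; [rewrite pdiff_0; cbn [INR]; change (RtoC 0) with C0; ring|].
  now rewrite pdiff_S, <- peval_contr.
Qed.

(** Convexity of the power; it supplies the sign that [contr_bound] requires of its factor. *)
Lemma pow_remainder_ge0 d r t t' :
  0 <= r -> 0 <= t' -> t' <= t ->
  0 <= (r + t) ^ d - (r + t') ^ d - INR d * r ^ (d - 1) * (t - t').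
Proof.
  intros Hr Ht' Ht; induction d as [|d IH]; [cbn; lra|].
  replace (S d - 1)%nat with d by lia.
  assert (E : r * (INR d * r ^ (d - 1)) = INR d * r ^ d).
  { destruct d; [cbn; ring|]; replace (S d - 1)%nat with d by lia; cbn [pow]; ring. }
  pose proof (pow_le_pow d (r + t) (r + t') ltac:(lra) ltac:(lra)).
  pose proof (pow_le_pow d (r + t) r ltac:(lra) ltac:(lra)).
  replace (_ - _ - _) with
    ((t - t') * ((r + t) ^ d - r ^ d) + t' * ((r + t) ^ d - (r + t') ^ d) +
     r * ((r + t) ^ d - (r + t') ^ d - INR d * r ^ (d - 1) * (t - t')))
    by (cbn [pow]; rewrite S_INR; ring [E]).
  apply Rplus_le_le_0_compat; [apply Rplus_le_le_0_compat|];
    apply Rmult_le_pos; lra.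
Qed.

(** Two points with the derivative frozen at a third, as the chord iteration requires; z' = x gives
    the usual second-order remainder. The three sums in the proof are matched by the three products
    of [pow_remainder_ge0]. *)
Lemma peval_taylor N d c x z z' r t t' :
  vnorm N x <= r -> vnorm N (vsub z x) <= t -> vnorm N (vsub z' x) <= t' ->
  vnorm N (vsub z z') <= t - t' ->
  Cabs (peval N d c z - peval N d c z' - pdiff N d c x (vsub z z'))%X <=
  pnorm N d c * ((r + t) ^ d - (r + t') ^ d - INR d * r ^ (d - 1) * (t - t')).
Proof.
  intros Hr Ht Ht' Hd.
  pose proof (vnorm_ge0 N x); pose proof (vnorm_ge0 N (vsub z z')).
  pose proof (vnorm_ge0 N (vsub z x)); pose proof (vnorm_ge0 N (vsub z' x)).
  pose proof (vnorm_le_add_sub N z x); pose proof (vnorm_le_add_sub N z' x).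
  revert c; induction d as [|d IH]; intros c.
  - rewrite !peval_0, pdiff_0; replace (_ - _ - _)%X with C0 by ring.
    rewrite Cabs_C0; cbn; lra.
  - pose proof (pow_le_pow d (r + t) (r + t') ltac:(lra) ltac:(lra)).
    pose proof (pow_le_pow d (r + t) r ltac:(lra) ltac:(lra)).
    pose proof (pow_remainder_ge0 d r t t' ltac:(lra) ltac:(lra) ltac:(lra)) as HB.
    set (F := fun j => peval N d (pcontr (S d) j c)).
    rewrite !peval_contr, pdiff_contr.
    transitivity (Cabs
      (Csum N (fun j => vsub z z' j * (F j z - F j x)) +
       Csum N (fun j => vsub z' x j * (F j z - F j z')) +
       Csum N (fun j => x j * (F j z - F j z' -
         pdiff N d (pcontr (S d) j c) x (vsub z z'))))%X).
    { apply Req_le; f_equal.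
      transitivity (Csum N (fun j => z j * F j z - z' j * F j z' -
        (vsub z z' j * F j x + x j * pdiff N d (pcontr (S d) j c) x (vsub z z'))))%X.
      - rewrite !Csum_sub, Csum_add; reflexivity.
      - rewrite <- !Csum_add; apply Csum_ext; intros; unfold vsub; ring. }
    eapply Rle_trans; [apply Cabs_triangle|].
    eapply Rle_trans; [apply Rplus_le_compat_r, Cabs_triangle|].
    pose proof (contr_bound N d c (vsub z z') (fun j => F j z - F j x)%X
      ((r + t) ^ d - r ^ d) ltac:(lra)
      (fun j _ => peval_lipschitz N d _ z x (r + t) r
         ltac:(lra) Hr ltac:(lra))) as B1.
    pose proof (contr_bound N d c (vsub z' x) (fun j => F j z - F j z')%X
      ((r + t) ^ d - (r + t') ^ d) ltac:(lra)
      (fun j _ => peval_lipschitz N d _ z z' (r + t) (r + t')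
         ltac:(lra) ltac:(lra) ltac:(lra))) as B2.
    pose proof (contr_bound N d c x (fun j => F j z - F j z' -
         pdiff N d (pcontr (S d) j c) x (vsub z z'))%X _ HB (fun j _ => IH _)) as B3.
    eapply Rle_trans;
      [apply Rplus_le_compat; [apply Rplus_le_compat; [apply B1|apply B2]|apply B3]|].
    rewrite <- !Rmult_plus_distr_l; apply Rmult_le_compat_l; [apply pnorm_ge0|].
    replace (S d - 1)%nat with d by lia.
    assert (E : r * (INR d * r ^ (d - 1)) = INR d * r ^ d).
    { destruct d; [cbn; ring|]; replace (S d - 1)%nat with d by lia; cbn [pow]; ring. }
    apply Rle_trans with ((t - t') * ((r + t) ^ d - r ^ d)
      + t' * ((r + t) ^ d - (r + t') ^ d)
      + r * ((r + t) ^ d - (r + t') ^ d - INR d * r ^ (d - 1) * (t - t'))).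
    + repeat apply Rplus_le_compat; apply Rmult_le_compat_r; lra.
    + apply Req_le; cbn [pow]; rewrite S_INR; ring [E].
Qed.

Lemma pdiff_lipschitz N d c z z' s s' v :
  vnorm N z <= s -> vnorm N z' <= s' -> vnorm N (vsub z z') <= s - s' ->
  Cabs (pdiff N d c z v - pdiff N d c z' v)%X <=
  pnorm N d c * (INR d * (s ^ (d - 1) - s' ^ (d - 1)) * vnorm N v).
Proof.
  intros Hs Hs' Hd; destruct d as [|d].
  - rewrite !pdiff_0; replace (_ - _)%X with C0 by ring.
    rewrite Cabs_C0; cbn; lra.
  - replace (S d - 1)%nat with d by lia.
    pose proof (vnorm_ge0 N z'); pose proof (vnorm_ge0 N (vsub z z')).
    pose proof (pow_le_pow d s s' ltac:(lra) ltac:(lra)).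
    pose proof (contr_bound N d c v (fun j => peval N d (pcontr (S d) j c) z -
      peval N d (pcontr (S d) j c) z')%X (s ^ d - s' ^ d) ltac:(lra)
      (fun j _ => peval_lipschitz N d _ z z' s s' Hs Hs' Hd)) as B.
    transitivity (Cabs (RtoC (INR (S d)) * Csum N (fun j => v j *
      (peval N d (pcontr (S d) j c) z - peval N d (pcontr (S d) j c) z')))%X).
    { apply Req_le; f_equal; rewrite !pdiff_S.
      transitivity (RtoC (INR (S d)) *
        (Csum N (fun j => v j * peval N d (pcontr (S d) j c) z) -
         Csum N (fun j => v j * peval N d (pcontr (S d) j c) z')))%X; [ring|].
      f_equal; rewrite <- Csum_sub; apply Csum_ext; intros; ring. }
    rewrite Cabs_mul, Cabs_RtoC, Rabs_pos_eq by apply pos_INR.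
    eapply Rle_trans; [apply Rmult_le_compat_l; [apply pos_INR|apply B]|].
    apply Req_le; ring.
Qed.

Lemma pdiff_bound N d c z v s :
  vnorm N z <= s ->
  Cabs (pdiff N d c z v) <= pnorm N d c * (INR d * s ^ (d - 1) * vnorm N v).
Proof.
  intros Hs; destruct d as [|d]; [rewrite pdiff_0, Cabs_C0; cbn; lra|].
  replace (S d - 1)%nat with d by lia.
  assert (0 <= s ^ d) by (apply pow_le; pose proof (vnorm_ge0 N z); lra).
  rewrite pdiff_S, Cabs_mul, Cabs_RtoC, Rabs_pos_eq by apply pos_INR.
  eapply Rle_trans; [apply Rmult_le_compat_l; [apply pos_INR|]|].
  - apply (contr_bound N d c v (fun j => peval N d (pcontr (S d) j c) z) (s ^ d));
      [easy|intros; now apply peval_bound].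
  - apply Req_le; ring.
Qed.

Lemma peval_scal N d c l z :
  peval N d c (vscal l z) = (Cpow l d * peval N d c z)%X.
Proof.
  revert c; induction d as [|d IH]; intros c.
  - rewrite !peval_0; cbn [Cpow]; ring.
  - rewrite !peval_contr, <- Csum_scal; apply Csum_ext; intros j _.
    rewrite IH; cbn [Cpow]; unfold vscal; ring.
Qed.

Lemma pdiff_scal N d c l z v :
  pdiff N d c (vscal l z) v = (Cpow l (d - 1) * pdiff N d c z v)%X.
Proof.
  destruct d as [|d]; [rewrite !pdiff_0; ring|].
  rewrite !pdiff_S; replace (S d - 1)%nat with d by lia.
  rewrite (Csum_ext N) with (G := fun j =>
    (Cpow l d * (v j * peval N d (pcontr (S d) j c) z))%X)
    by (intros; rewrite peval_scal; ring).
  rewrite Csum_scal; ring.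
Qed.

(** * The majorant function *)

Lemma bernoulli_sub k s : 0 <= s -> s <= 1 -> 1 - INR k * s <= (1 - s) ^ k.
Proof.
  intros H0 H1; induction k as [|k IH]; [cbn; lra|].
  rewrite S_INR; cbn [pow]; pose proof (pos_INR k).
  apply Rle_trans with ((1 - s) * (1 - INR k * s)); [nra|].
  apply Rmult_le_compat_l; lra.
Qed.

(** Bernoulli's inequality replaces 1 - k t/2 by (1 - t/2)^k; what is left is the k-th power of (1 +
    t)(1 - t/2)^2 = 1 - t^2 (3 - t)/4. *)
Lemma pow_mul_sqr_le1 k t :
  0 <= t -> t <= 2 -> INR k * t / 2 <= 1 ->
  (1 + t) ^ k * ((1 - INR k * t / 2) * (1 - INR k * t / 2)) <= 1.
Proof.
  intros H0 H2 Hk.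
  pose proof (bernoulli_sub k (t / 2) ltac:(lra) ltac:(lra)) as HB.
  apply Rle_trans with ((1 + t) ^ k * ((1 - t / 2) ^ k * (1 - t / 2) ^ k)).
  - apply Rmult_le_compat_l; [apply pow_le; lra|].
    apply Rmult_le_compat; lra.
  - rewrite <- !Rpow_mult_distr; apply Rle_trans with (1 ^ k); [|rewrite pow1; lra].
    apply pow_incr; split.
    + apply Rmult_le_pos; [lra|apply Rle_0_sqr].
    + assert (0 <= t * t * (3 - t)) by (apply Rmult_le_pos; [nra|lra]); lra.
Qed.

(** With p = 1 - D t/2 and q = 1 - M D t/2, both 1/p^2 - 1 = (1 - p)(1/p + 1/p^2) and its analogue
    for q hold, and 1 - q = M (1 - p). As q <= p, the factor M can move inside. The right side is
    the derivative of the gamma term of the majorant. *)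
Lemma pow_growth d D M t :
  (1 <= d)%nat -> (d <= D)%nat -> 1 <= M -> 0 <= t -> INR D * M / 2 * t < 1 ->
  M * ((1 + t) ^ (d - 1) - 1) <=
  / ((1 - INR D * M / 2 * t) * (1 - INR D * M / 2 * t)) - 1.
Proof.
  intros Hd HD HM Ht Hg.
  assert (1 <= INR D) by (apply (le_INR 1); lia).
  set (X := INR D * t / 2); set (p := 1 - X).
  set (q := 1 - INR D * M / 2 * t) in *.
  assert (Eq : q = 1 - M * X) by (unfold q, X; field).
  assert (HX : 0 <= X) by (unfold X; nra).
  assert (Hqp : q <= p) by (unfold p; rewrite Eq; nra).
  assert (Hq : 0 < q) by (unfold q; lra).
  assert (Ht2 : t <= 2) by (unfold p, X in *; nra).
  assert (H1 : (1 + t) ^ (d - 1) <= / (p * p)).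
  { apply Rle_trans with ((1 + t) ^ D); [apply Rle_pow; [lra|lia]|].
    apply Rmult_le_reg_r with (p * p); [nra|].
    rewrite Rinv_l by nra; apply pow_mul_sqr_le1; [easy|easy|unfold p, X in *; lra]. }
  assert (Hinv : / p <= / q) by (apply Rinv_le_contravar; easy).
  assert (0 < / p) by (apply Rinv_0_lt_compat; lra).
  apply Rle_trans with (M * (/ (p * p) - 1)); [apply Rmult_le_compat_l; lra|].
  replace (M * (/ (p * p) - 1)) with (M * X * (/ p + / p * / p))
    by (replace X with (1 - p) by (unfold p; ring); field; lra).
  replace (/ (q * q) - 1) with (M * X * (/ q + / q * / q))
    by (replace (M * X) with (1 - q) by lra; field; lra).
  apply Rmult_le_compat_l; nra.
Qed.

Lemma derivable_majorant_gap g c d s :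
  g * s < 1 ->
  derivable_pt_lim (fun s => g * (s * s) / (1 - g * s) - c * ((1 + s) ^ d - INR d * s))
    s (/ ((1 - g * s) * (1 - g * s)) - 1 - c * (INR d * (1 + s) ^ (d - 1) - INR d)).
Proof.
  intros Hs.
  assert (D1 : derivable_pt_lim (fun s => g * (s * s) / (1 - g * s)) s
    ((g * (1 * s + s * 1) * (1 - g * s) - (0 - g * 1) * (g * (s * s)))
       / Rsqr (1 - g * s))).
  { apply (derivable_pt_lim_div (fun s => g * (s * s)) (fun s => 1 - g * s)); [| |lra].
    - apply (derivable_pt_lim_scal (fun s => s * s)).
      apply (derivable_pt_lim_mult id id); apply derivable_pt_lim_id.
    - apply (derivable_pt_lim_minus (fun _ => 1) (fun s => g * s));
        [apply derivable_pt_lim_const|].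
      apply (derivable_pt_lim_scal id), derivable_pt_lim_id. }
  assert (D2 : derivable_pt_lim (fun s => (1 + s) ^ d) s
    (INR d * (1 + s) ^ pred d * (0 + 1))).
  { apply (derivable_pt_lim_comp (fun s => 1 + s) (fun y => y ^ d)).
    - apply (derivable_pt_lim_plus (fun _ => 1) id);
        [apply derivable_pt_lim_const|apply derivable_pt_lim_id].
    - apply derivable_pt_lim_pow. }
  replace (_ - 1 - _) with
    ((g * (1 * s + s * 1) * (1 - g * s) - (0 - g * 1) * (g * (s * s)))
       / Rsqr (1 - g * s) -
     c * (INR d * (1 + s) ^ pred d * (0 + 1) - INR d * 1))
    by (rewrite Nat.sub_1_r; unfold Rsqr; field; lra).
  apply (derivable_pt_lim_minus (fun s => g * (s * s) / (1 - g * s))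
    (fun s => c * ((1 + s) ^ d - INR d * s))); [easy|].
  apply (derivable_pt_lim_scal (fun s => (1 + s) ^ d - INR d * s)).
  apply (derivable_pt_lim_minus (fun s => (1 + s) ^ d) (fun s => INR d * s)); [easy|].
  apply (derivable_pt_lim_scal id), derivable_pt_lim_id.
Qed.

(** [pow_growth] integrated from t' to t: the mean value theorem is applied to the difference of the
    two sides. In use, c is mu / sqrt(d_i) and M is mu sqrt D. *)
Lemma majorant_diff d D M c t t' :
  (1 <= d)%nat -> (d <= D)%nat -> 1 <= M -> 0 <= c -> c * INR d <= M ->
  0 <= t' -> t' <= t -> INR D * M / 2 * t < 1 ->
  c * ((1 + t) ^ d - (1 + t') ^ d - INR d * (t - t')) <=
  INR D * M / 2 * (t * t) / (1 - INR D * M / 2 * t) -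
  INR D * M / 2 * (t' * t') / (1 - INR D * M / 2 * t').
Proof.
  intros Hd HD HM Hc HcM Ht' Ht Hg; set (g := INR D * M / 2) in *.
  assert (0 <= g) by (pose proof (pos_INR D); unfold g; nra).
  destruct Ht as [Ht| ->]; [|lra].
  assert (Hlt : forall s, s <= t -> g * s < 1)
    by (intros s Hs; apply Rle_lt_trans with (g * t); [now apply Rmult_le_compat_l|easy]).
  destruct (MVT_cor2 _ (fun s => / ((1 - g * s) * (1 - g * s)) - 1 -
    c * (INR d * (1 + s) ^ (d - 1) - INR d)) t' t Ht
    (fun s Hs => derivable_majorant_gap g c d s (Hlt s (proj2 Hs))))
    as (s & E & Hs1 & Hs2).
  assert (G : c * (INR d * (1 + s) ^ (d - 1) - INR d) <=
    / ((1 - g * s) * (1 - g * s)) - 1).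
  { eapply Rle_trans; [|apply (pow_growth d D M s); try easy; try lra].
    - replace (c * _) with (c * INR d * ((1 + s) ^ (d - 1) - 1)) by ring.
      apply Rmult_le_compat_r; [|easy].
      pose proof (pow_R1_Rle (1 + s) (d - 1) ltac:(lra)); lra.
    - apply Hlt; lra. }
  assert (0 <= (/ ((1 - g * s) * (1 - g * s)) - 1 -
    c * (INR d * (1 + s) ^ (d - 1) - INR d)) * (t - t')) by (apply Rmult_le_pos; lra).
  lra.
Qed.

(** The exponent d - 1 in place of d - 2 costs nothing essential since 1 <= L, and makes the factor
    one that [pow_growth] bounds. *)
Lemma pow_second_order d r b L :
  0 <= r -> 0 <= b -> r + b <= L -> 1 <= L ->
  (r + b) ^ d - r ^ d - INR d * r ^ (d - 1) * b <=
  INR d * (INR d - 1) / 2 * L ^ (d - 1) * (b * b).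
Proof.
  intros Hr Hb HL H1; induction d as [|d IH]; [cbn; lra|].
  replace (S d - 1)%nat with d by lia.
  destruct d as [|d]; [cbn; lra|].
  replace (S d - 1)%nat with d in IH by lia.
  pose proof (pos_INR (S d)); pose proof (pos_INR d).
  assert (Hrd : r ^ d <= L ^ d) by (apply pow_incr; lra).
  assert (HLd : L ^ d <= L ^ S d) by (apply Rle_pow; [lra|lia]).
  assert (Hp : 0 <= L ^ d) by (apply pow_le; lra).
  replace (_ - _ - _) with
    ((r + b) * ((r + b) ^ S d - r ^ S d - INR (S d) * r ^ d * b)
      + INR (S d) * r ^ d * (b * b))
    by (rewrite (S_INR (S d)); cbn [pow]; ring).
  apply Rle_trans with (L * (INR (S d) * (INR (S d) - 1) / 2 * L ^ d * (b * b))
      + INR (S d) * L ^ S d * (b * b)).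
  - apply Rplus_le_compat.
    + eapply Rle_trans; [apply Rmult_le_compat_l; [lra|apply IH]|].
      apply Rmult_le_compat_r; [|lra].
      apply Rmult_le_pos; [|nra]; apply Rmult_le_pos; [|easy].
      rewrite S_INR; nra.
    + apply Rmult_le_compat_r; [nra|]; apply Rmult_le_compat_l; lra.
  - apply Req_le; rewrite (S_INR (S d)); cbn [pow]; field.
Qed.

(** * Numerical constants and iterates of the majorant *)

Lemma sqrt_17_bounds : 37 / 9 < sqrt 17.
Proof.
  rewrite <- (sqrt_square (37 / 9)) by lra; apply sqrt_lt_1_alt; lra.
Qed.

(** The inequality is equivalent to 37/9 <= sqrt 17. *)
Lemma alpha0_le : alpha0 <= 1 / 6.
Proof. unfold alpha0; pose proof sqrt_17_bounds; lra. Qed.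

Lemma sigma_alpha_spec a :
  0 < a -> a <= 1 / 6 ->
  1 <= sigma_alpha a <= 2 /\
  a * sigma_alpha a <= 1 / 3 /\
  2 * a * (sigma_alpha a * sigma_alpha a) = (1 + a) * sigma_alpha a - 1.
Proof.
  intros H0 H1; set (S := sqrt ((1 + a) ^ 2 - 8 * a)).
  assert (HS : S * S = (1 + a) ^ 2 - 8 * a) by (apply sqrt_sqrt; nra).
  assert (HS0 : 0 <= S) by apply sqrt_pos.
  assert (Es : 4 * (a * sigma_alpha a) = 1 + a - S)
    by (unfold sigma_alpha; fold S; field; lra).
  (* S^2 - (1 - 7a)^2 = 8a (1 - 6a), which is where 1/6 enters. This bound means sigma <= 2, and the
     next one means sigma >= 1. *)
  assert (1 - 7 * a <= S) by nra.
  assert (S <= 1 - 3 * a) by nra.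
  assert (Hs2 : sigma_alpha a <= 2) by nra.
  split; [split; nra|split; [nra|]].
  apply Rmult_eq_reg_l with (8 * a); [|lra].
  replace (8 * a * (2 * a * (sigma_alpha a * sigma_alpha a)))
    with (4 * (a * sigma_alpha a) * (4 * (a * sigma_alpha a))) by ring.
  replace (8 * a * ((1 + a) * sigma_alpha a - 1))
    with (2 * (1 + a) * (4 * (a * sigma_alpha a)) - 8 * a) by ring.
  rewrite Es; nra.
Qed.

(** At a = 0.049 the product is about 0.0518; 208/1000 in the proof is four times the rounded
    value. *)
Lemma alpha_sigma_small a :
  0 < a -> a <= 49 / 1000 -> a * sigma_alpha a <= 52 / 1000.
Proof.
  intros H0 H1; set (S := sqrt ((1 + a) ^ 2 - 8 * a)).
  assert (HS : S * S = (1 + a) ^ 2 - 8 * a) by (apply sqrt_sqrt; nra).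
  assert (HS0 : 0 <= S) by apply sqrt_pos.
  assert (Es : 4 * (a * sigma_alpha a) = 1 + a - S)
    by (unfold sigma_alpha; fold S; field; lra).
  assert (1 + a - 208 / 1000 <= S) by nra.
  lra.
Qed.

Definition smale_majorant (b g t : R) : R := b + g * (t * t) / (1 - g * t).

Fixpoint majseq (b g : R) (k : nat) : R :=
  match k with O => 0 | S k' => smale_majorant b g (majseq b g k') end.

Lemma majorant_mono b g t t' :
  0 <= g -> 0 <= t' -> t' <= t -> g * t < 1 -> smale_majorant b g t' <= smale_majorant b g t.
Proof.
  intros Hg Ht' Ht H1; unfold smale_majorant, Rdiv; apply Rplus_le_compat_l.
  apply Rmult_le_compat.
  - apply Rmult_le_pos; nra.
  - apply Rlt_le, Rinv_0_lt_compat; nra.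
  - apply Rmult_le_compat_l; nra.
  - apply Rinv_le_contravar; nra.
Qed.

(** When g b = a, equality holds by the quadratic relation for sigma; a smaller g only lowers the
    left side. *)
Lemma majorant_sigma a b g :
  0 < a -> a <= 1 / 6 -> 0 <= b -> 0 <= g -> g * b <= a ->
  smale_majorant b g (sigma_alpha a * b) <= sigma_alpha a * b.
Proof.
  intros H0 H1 Hb Hg Hgb.
  destruct (sigma_alpha_spec a H0 H1) as ((Hs1 & Hs2) & Has & E).
  set (s := sigma_alpha a) in *.
  assert (Hgs : g * (s * b) <= a * s) by nra.
  unfold smale_majorant.
  apply Rle_trans with (b + s * b * (a * s / (1 - a * s))).
  - apply Rplus_le_compat_l.
    replace (g * (s * b * (s * b)) / (1 - g * (s * b)))
      with (s * b * (g * (s * b) / (1 - g * (s * b)))) by (field; lra).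
    apply Rmult_le_compat_l; [nra|].
    apply Rmult_le_compat; [apply Rmult_le_pos; nra| |easy|].
    + apply Rlt_le, Rinv_0_lt_compat; lra.
    + apply Rinv_le_contravar; lra.
  - apply Req_le, Rmult_eq_reg_r with (1 - a * s); [|lra].
    replace ((b + s * b * (a * s / (1 - a * s))) * (1 - a * s))
      with (b * (1 - a * s + a * (s * s))) by (field; lra).
    replace (a * (s * s)) with (((1 + a) * s - 1) / 2) by lra.
    transitivity (b * (s - a * (s * s))); [|ring].
    replace (a * (s * s)) with (((1 + a) * s - 1) / 2) by lra.
    field.
Qed.

Lemma majseq_spec b g T k :
  0 <= b -> 0 <= g -> 0 <= T -> g * T < 1 -> smale_majorant b g T <= T ->
  0 <= majseq b g k /\ majseq b g k <= majseq b g (S k) /\ majseq b g (S k) <= T.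
Proof.
  intros Hb Hg HT HgT HmT.
  assert (M0 : smale_majorant b g 0 = b) by (unfold smale_majorant; field; lra).
  induction k as [|k (IH1 & IH2 & IH3)].
  - cbn [majseq]; rewrite M0; pose proof (majorant_mono b g T 0 Hg); lra.
  - split; [lra|]; assert (g * majseq b g (S k) < 1) by nra; split.
    + change (smale_majorant b g (majseq b g k) <= smale_majorant b g (majseq b g (S k))).
      now apply majorant_mono.
    + change (smale_majorant b g (majseq b g (S k)) <= T).
      eapply Rle_trans; [|apply HmT]; apply majorant_mono; lra.
Qed.

(** * Linear systems and completeness *)

(** Gaussian elimination of the last unknown. If the last column is zero, the last basis vector is a
    solution. *)
Lemma homogeneous_solution m (A : nat -> nat -> C) :
  exists w : Cvec, vnonzero (S m) w /\
    forall i, (i < m)%nat -> Csum (S m) (fun j => A i j * w j)%X = C0.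
Proof.
  revert A; induction m as [|m IH]; intros A.
  - exists (fun _ => C1); split; [|intros; lia].
    exists O; split; [lia|intros [=]; lra].
  - destruct (classic (exists p, (p <= m)%nat /\ A p (S m) <> C0)) as [(p & Hp & HA)|Hn].
    (* [row] enumerates the equations other than the pivot equation p. *)
    + set (row := fun i => if (i <? p)%nat then i else S i).
      set (q := fun i => (A (row i) (S m) * Cinv (A p (S m)))%X).
      destruct (IH (fun i j => A (row i) j - q i * A p j)%X) as (w & (j0 & Hj0 & Hw0) & Hw).
      set (last := (- (Cinv (A p (S m)) * Csum (S m) (fun j => A p j * w j)))%X).
      set (w' := fun j => if (j =? S m)%nat then last else w j).
      assert (Ew : forall i, Csum (S (S m)) (fun j => A i j * w' j)%X =
        (Csum (S m) (fun j => A i j * w j) + A i (S m) * last)%X).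
      { intros i; rewrite Csum_S; f_equal.
        - apply Csum_ext; intros j Hj; unfold w'.
          now rewrite (proj2 (Nat.eqb_neq j (S m))) by lia.
        - unfold w'; now rewrite Nat.eqb_refl. }
      assert (Ep : Csum (S (S m)) (fun j => A p j * w' j)%X = C0).
      { rewrite Ew; unfold last.
        transitivity ((C1 - A p (S m) * Cinv (A p (S m))) *
          Csum (S m) (fun j => A p j * w j))%X; [ring|].
        rewrite Cinv_r by easy; ring. }
      exists w'; split.
      { exists j0; split; [lia|]; unfold w'.
        now rewrite (proj2 (Nat.eqb_neq j0 (S m))) by lia. }
      assert (Er : forall i, (i < m)%nat ->
        Csum (S (S m)) (fun j => A (row i) j * w' j)%X = C0).
      { intros i Hi; rewrite Ew; rewrite <- (Hw i Hi).
        rewrite (Csum_ext (S m)) with (F := fun j => ((A (row i) j - q i * A p j) * w j)%X)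
          (G := fun j => (A (row i) j * w j - q i * (A p j * w j))%X) by (intros; ring).
        rewrite Csum_sub, Csum_scal; unfold last, q; ring. }
      intros i Hi; destruct (lt_eq_lt_dec i p) as [[Hlt| ->]|Hgt]; [|easy|].
      * specialize (Er i ltac:(lia)); unfold row in Er.
        now rewrite (proj2 (Nat.ltb_lt i p)) in Er by easy.
      * specialize (Er (i - 1)%nat ltac:(lia)); unfold row in Er.
        rewrite (proj2 (Nat.ltb_ge (i - 1) p)) in Er by lia.
        now replace (S (i - 1)) with i in Er by lia.
    + exists (fun j => if (j =? S m)%nat then C1 else C0); split.
      { exists (S m); split; [lia|]; rewrite Nat.eqb_refl; intros [=]; lra. }
      intros i Hi; apply Csum_zero; intros j Hj.
      destruct (Nat.eqb_spec j (S m)) as [->|]; [|ring].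
      replace (A i (S m)) with C0; [ring|].
      symmetry; apply NNPP; intros Hi'; apply Hn; exists i; split; [lia|easy].
Qed.

(** * Limits of vector sequences *)

Lemma Cabs_le_sum a : Cabs a <= Rabs (fst a) + Rabs (snd a).
Proof.
  pose proof (Rabs_pos (fst a)); pose proof (Rabs_pos (snd a)).
  apply le_of_sqr_le; [lra|]; rewrite Cabs_sqr; unfold Cnorm2.
  replace (fst a * fst a) with (Rabs (fst a) * Rabs (fst a))
    by (rewrite <- Rabs_mult; apply Rabs_pos_eq; nra).
  replace (snd a * snd a) with (Rabs (snd a) * Rabs (snd a))
    by (rewrite <- Rabs_mult; apply Rabs_pos_eq; nra).
  nra.
Qed.

Lemma vnorm_le_sum m u : vnorm m u <= Rsum m (fun j => Cabs (u j)).
Proof.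
  induction m as [|m IH]; [unfold vnorm; rewrite Rsum_0, sqrt_0, Rsum_0; lra|].
  pose proof (Cabs_ge0 (u m)); pose proof (vnorm_ge0 m u).
  apply le_of_sqr_le; [rewrite Rsum_S; lra|].
  rewrite vnorm_sqr, Rsum_S, Rsum_S, <- vnorm_sqr, <- Cabs_sqr; nra.
Qed.

Lemma Un_cv_Rsum0 m (F : nat -> nat -> R) :
  (forall j, (j < m)%nat -> Un_cv (fun k => F k j) 0) ->
  Un_cv (fun k => Rsum m (F k)) 0.
Proof.
  induction m as [|m IH]; intros H.
  - intros e He; exists O; intros k _; rewrite Rsum_0; unfold R_dist.
    now rewrite Rminus_diag, Rabs_R0.
  - apply Un_cv_ext with (fun k => Rsum m (F k) + F k m).
    + intros k; now rewrite Rsum_S.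
    + rewrite <- (Rplus_0_r 0) at 1; apply CV_plus; auto.
Qed.

Lemma Un_cv_sub_abs u l : Un_cv u l -> Un_cv (fun k => Rabs (l - u k)) 0.
Proof.
  intros H e He; destruct (H e He) as (k0 & Hk0); exists k0; intros k Hk.
  unfold R_dist in *; rewrite Rminus_0_r, Rabs_Rabsolu, Rabs_minus_sym; auto.
Qed.

Lemma telescoped_norm m (u : nat -> Cvec) t :
  (forall k, vnorm m (vsub (u (S k)) (u k)) <= t (S k) - t k) ->
  forall p k, vnorm m (vsub (u (p + k)%nat) (u k)) <= t (p + k)%nat - t k.
Proof.
  intros H p k; induction p as [|p IH].
  - cbn [Nat.add]; rewrite vnorm_zero; [lra|intros; unfold vsub; ring].
  - eapply Rle_trans; [apply (vnorm_sub_trans m _ (u (p + k)%nat))|].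
    specialize (H (p + k)%nat); cbn [Nat.add]; lra.
Qed.

(** Increments dominated by those of a convergent real sequence make every real and imaginary
    coordinate Cauchy. *)
Lemma vector_limit m (u : nat -> Cvec) t l :
  (forall k, vnorm m (vsub (u (S k)) (u k)) <= t (S k) - t k) -> Un_cv t l ->
  exists a : Cvec, forall k, vnorm m (vsub a (u k)) <= l - t k.
Proof.
  intros Hstep Hl.
  pose proof (telescoped_norm m u t Hstep) as Htel.
  assert (Hgrow : Un_growing t).
  { intros k; specialize (Hstep k); pose proof (vnorm_ge0 m (vsub (u (S k)) (u k))); lra. }
  pose proof (fun k => growing_ineq t l Hgrow Hl k) as Htl.
  assert (Hcauchy : forall (pr : C -> R),
    (forall a b, Rabs (pr a - pr b) <= Cabs (a - b)%X) ->
    forall j, (j < m)%nat -> Cauchy_crit (fun k => pr (u k j))).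
  { intros pr Hpr j Hj.
    assert (Hd : forall p k, (k <= p)%nat -> Rabs (pr (u p j) - pr (u k j)) <= l - t k).
    { intros p k Hk; eapply Rle_trans; [apply Hpr|].
      eapply Rle_trans; [apply (Cabs_le_vnorm m (vsub (u p) (u k)) j Hj)|].
      specialize (Htel (p - k)%nat k); replace (p - k + k)%nat with p in Htel by lia.
      specialize (Htl p); lra. }
    intros e He; destruct (Hl e He) as (k0 & Hk0); exists k0.
    assert (He' : forall k, (k >= k0)%nat -> l - t k < e).
    { intros k Hk; specialize (Hk0 k Hk); unfold R_dist in Hk0.
      apply Rabs_def2 in Hk0; lra. }
    intros p q Hp Hq; unfold R_dist; destruct (le_lt_dec q p) as [Hqp|Hqp].
    - eapply Rle_lt_trans; [now apply Hd|auto].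
    - rewrite Rabs_minus_sym; eapply Rle_lt_trans; [apply Hd; lia|auto]. }
  assert (Hlim : forall j, exists a : C, (j < m)%nat ->
    Un_cv (fun k => fst (u k j)) (fst a) /\ Un_cv (fun k => snd (u k j)) (snd a)).
  { intros j; destruct (lt_dec j m) as [Hj|]; [|exists C0; now intros].
    destruct (R_complete _ (Hcauchy fst (fun a b => Cabs_fst (a - b)%X) j Hj)) as (p & Hp).
    destruct (R_complete _ (Hcauchy snd (fun a b => Cabs_snd (a - b)%X) j Hj)) as (q & Hq).
    now exists (p, q). }
  set (a := fun j => proj1_sig (constructive_indefinite_description _ (Hlim j))).
  assert (Ha : forall j, (j < m)%nat ->
    Un_cv (fun k => fst (u k j)) (fst (a j)) /\ Un_cv (fun k => snd (u k j)) (snd (a j)))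
    by (intros j; unfold a; apply proj2_sig).
  assert (H0 : Un_cv (fun k => Rsum m (fun j =>
    Rabs (fst (a j) - fst (u k j)) + Rabs (snd (a j) - snd (u k j)))) 0).
  { apply Un_cv_Rsum0; intros j Hj; destruct (Ha j Hj).
    rewrite <- (Rplus_0_r 0) at 1; apply CV_plus; now apply Un_cv_sub_abs. }
  (* The error at k is compared with that at a later index p, where the coordinates are within e of
     the limit; from k to p the sequence moves by at most l - t k. *)
  exists a; intros k; apply le_epsilon; intros e He.
  destruct (H0 e He) as (k0 & Hk0); set (p := (k0 + k)%nat).
  specialize (Hk0 p ltac:(unfold p; lia)); unfold R_dist in Hk0.
  rewrite Rminus_0_r in Hk0; apply Rabs_def2 in Hk0 as [Hk0 _].
  eapply Rle_trans; [apply (vnorm_sub_trans m _ (u p))|].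
  specialize (Htel k0 k); fold p in Htel; specialize (Htl p).
  enough (vnorm m (vsub a (u p)) <= e) by lra.
  apply Rlt_le; eapply Rle_lt_trans; [apply vnorm_le_sum|].
  eapply Rle_lt_trans; [|apply Hk0].
  apply Rsum_le; intros j _; apply Cabs_le_sum.
Qed.

(** Replaces continuity when an equation is passed to the limit: the limit's residual is a fixed
    number bounded by K times a vanishing gap. *)
Lemma le0_of_le_gap c K t l :
  0 <= K -> Un_cv t l -> (forall k, c <= K * (l - t k)) -> c <= 0.
Proof.
  intros HK Hl H; apply le_epsilon; intros e He.
  (* K + 1 keeps the quotient meaningful when K = 0. *)
  destruct (Hl (e / (K + 1)) ltac:(apply Rdiv_lt_0_compat; lra)) as (k & Hk).
  specialize (Hk k ltac:(lia)); unfold R_dist in Hk; apply Rabs_def2 in Hk as [_ Hk].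
  specialize (H k).
  assert (K * (l - t k) <= K * (e / (K + 1))) by (apply Rmult_le_compat_l; lra).
  assert (K * (e / (K + 1)) <= e).
  { apply Rmult_le_reg_r with (K + 1); [lra|].
    replace (K * (e / (K + 1)) * (K + 1)) with (K * e) by (field; lra); nra. }
  lra.
Qed.

Lemma pow_sub_le d s s' :
  0 <= s' -> s' <= s -> s ^ d - s' ^ d <= INR d * s ^ (d - 1) * (s - s').
Proof.
  intros H0 H1; induction d as [|d IH]; [cbn; lra|].
  replace (S d - 1)%nat with d by lia.
  assert (E : s * (INR d * s ^ (d - 1)) = INR d * s ^ d).
  { destruct d; [cbn; ring|]; replace (S d - 1)%nat with d by lia; cbn [pow]; ring. }
  pose proof (pow_le_pow d s s' H0 H1).
  replace (s ^ S d - s' ^ S d) with (s * (s ^ d - s' ^ d) + (s - s') * s' ^ d)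
    by (cbn [pow]; ring).
  apply Rle_trans with (s * (INR d * s ^ (d - 1) * (s - s')) + (s - s') * s ^ d).
  - apply Rplus_le_compat; apply Rmult_le_compat_l; lra.
  - apply Req_le; rewrite S_INR; ring [E].
Qed.

Lemma peval_ext N d c z z' :
  (forall j, (j < N)%nat -> z j = z' j) -> peval N d c z = peval N d c z'.
Proof.
  intros H; revert c; induction d as [|d IH]; intros c.
  - now rewrite !peval_0.
  - rewrite !peval_contr; apply Csum_ext; intros j Hj; now rewrite H, IH.
Qed.

(** * Weighted norms of systems *)

(** The norm after diag(1 / sqrt(d_i)), which undoes the scaling inside mu: at a unit vector,
    bounding (Df)^(-1) diag(sqrt(d_i)) is bounding a norm by a multiple of [wnorm] of its image. *)
Definition wnorm (n : nat) (d : nat -> nat) (r : Cvec) : R :=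
  vnorm n (fun i => RtoC (/ sqrt (INR (d i))) * r i)%X.

Lemma wnorm_ext n d r r' :
  (forall i, (i < n)%nat -> r i = r' i) -> wnorm n d r = wnorm n d r'.
Proof. intros H; apply vnorm_ext; intros i Hi; now rewrite H. Qed.

Lemma wnorm_triangle n d r r' : wnorm n d (vadd r r') <= wnorm n d r + wnorm n d r'.
Proof.
  eapply Rle_trans; [|apply vnorm_triangle].
  apply Req_le, vnorm_ext; intros; unfold vadd; ring.
Qed.

Lemma wnorm_sub_sym n d r r' : wnorm n d (vsub r r') = wnorm n d (vsub r' r).
Proof.
  unfold wnorm; transitivity
    (vnorm n (vsub (fun i => RtoC (/ sqrt (INR (d i))) * r i)
                   (fun i => RtoC (/ sqrt (INR (d i))) * r' i)))%X;
    [apply vnorm_ext; intros; unfold vsub; ring|].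
  rewrite vnorm_sub_sym; apply vnorm_ext; intros; unfold vsub; ring.
Qed.

Lemma wnorm_bound n d f r B :
  (forall i, (i < n)%nat -> (1 <= d i)%nat) -> 0 <= B ->
  (forall i, (i < n)%nat ->
    Cabs (r i) <= pnorm (S n) (d i) (f i) * (sqrt (INR (d i)) * B)) ->
  wnorm n d r <= BWnorm n d f * B.
Proof.
  intros Hd HB H; pose proof (sqrt_pos (Rsum n (fun i => pnorm2 (S n) (d i) (f i)))) as HP.
  change (0 <= BWnorm n d f) in HP; apply le_of_sqr_le; [nra|].
  replace (BWnorm n d f * B * _)
    with (B * B * (BWnorm n d f * BWnorm n d f)) by ring.
  assert (E : BWnorm n d f * BWnorm n d f = Rsum n (fun i => pnorm2 (S n) (d i) (f i)))
    by (apply sqrt_sqrt, Rsum_ge0; intros; apply pnorm2_ge0).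
  unfold wnorm; rewrite E, vnorm_sqr, <- Rsum_scal.
  apply Rsum_le; intros i Hi; specialize (H i Hi).
  rewrite Cnorm2_mul, Cnorm2_RtoC, <- Cabs_sqr, <- pnorm_sqr.
  assert (0 < sqrt (INR (d i))) by (apply sqrt_lt_R0, lt_0_INR; specialize (Hd i Hi); lia).
  set (s := sqrt (INR (d i))) in *; set (p := pnorm (S n) (d i) (f i)) in *.
  pose proof (Cabs_ge0 (r i)).
  replace (/ s * / s * (Cabs (r i) * Cabs (r i)))
    with ((Cabs (r i) / s) * (Cabs (r i) / s)) by (field; lra).
  replace (B * B * (p * p)) with ((p * B) * (p * B)) by ring.
  assert (Cabs (r i) / s <= p * B).
  { apply Rmult_le_reg_r with s; [easy|].
    replace (Cabs (r i) / s * s) with (Cabs (r i)) by (field; lra); lra. }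
  assert (0 <= Cabs (r i) / s) by (apply Rmult_le_pos; [easy|];
    apply Rlt_le, Rinv_0_lt_compat; easy).
  apply Rmult_le_compat; easy.
Qed.

Lemma Dsys_pdiff n d f x w i : Dsys n d f x w i = pdiff (S n) (d i) (f i) x w.
Proof. reflexivity. Qed.

Lemma Dsys_ext n d f x w w' i :
  (forall j, (j < S n)%nat -> w j = w' j) -> Dsys n d f x w i = Dsys n d f x w' i.
Proof. intros H; apply Csum_ext; intros j Hj; now rewrite H. Qed.

Lemma Dsys_add n d f x u v i :
  Dsys n d f x (vadd u v) i = (Dsys n d f x u i + Dsys n d f x v i)%X.
Proof. unfold Dsys; rewrite <- Csum_add; apply Csum_ext; intros; unfold vadd; ring. Qed.

Lemma Dsys_sub n d f x u v i :
  Dsys n d f x (vsub u v) i = (Dsys n d f x u i - Dsys n d f x v i)%X.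
Proof. unfold Dsys; rewrite <- Csum_sub; apply Csum_ext; intros; unfold vsub; ring. Qed.

Lemma Dsys_scal n d f x c u i :
  Dsys n d f x (vscal c u) i = (c * Dsys n d f x u i)%X.
Proof. unfold Dsys; rewrite <- Csum_scal; apply Csum_ext; intros; unfold vscal; ring. Qed.

Lemma Dsys_euler n d f z i :
  Dsys n d f z z i = (RtoC (INR (d i)) * sys_eval n d f z i)%X.
Proof. rewrite Dsys_pdiff; apply pdiff_euler. Qed.

Lemma Dsys_scal_base n d f l z w i :
  Dsys n d f (vscal l z) w i = (Cpow l (d i - 1) * Dsys n d f z w i)%X.
Proof. rewrite !Dsys_pdiff; apply pdiff_scal. Qed.

Lemma sys_eval_scal n d f l z i :
  sys_eval n d f (vscal l z) i = (Cpow l (d i) * sys_eval n d f z i)%X.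
Proof. apply peval_scal. Qed.

(* Injectivity on the n-dimensional complement suffices for surjectivity: the
   n equations Df(z) w = s v together with <w, z> = 0 are n + 1 homogeneous
   equations in the n + 2 unknowns (w, s). *)
Lemma rank_full_of_injective n d f z :
  (forall v, orth n v z -> (forall i, (i < n)%nat -> Dsys n d f z v i = C0) ->
    vnorm (S n) v = 0) ->
  rank_full n d f z.
Proof.
  intros Hinj v.
  destruct (homogeneous_solution (S n) (fun i j =>
    if (i <? n)%nat then
      if (j <=? n)%nat then pderiv (S n) (d i) (f i) j z else - v i
    else if (j <=? n)%nat then Cconj (z j) else C0)%X) as (w & Hw0 & Hw).
  set (s := w (S n)).
  assert (Hv : forall i, (i < n)%nat -> Dsys n d f z w i = (s * v i)%X).
  { intros i Hi; specialize (Hw i ltac:(lia)); cbn beta in Hw.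
    rewrite Csum_S in Hw.
    rewrite (proj2 (Nat.ltb_lt i n)), (proj2 (Nat.leb_gt (S n) n)) in Hw by lia.
    replace (s * v i)%X with
      (Dsys n d f z w i - (Dsys n d f z w i + - v i * s))%X by ring.
    replace (Dsys n d f z w i + - v i * s)%X with C0; [ring|].
    rewrite <- Hw; f_equal; apply Csum_ext; intros j Hj.
    now rewrite (proj2 (Nat.leb_le j n)) by lia. }
  assert (Ho : inner (S n) w z = C0).
  { specialize (Hw n ltac:(lia)); cbn beta in Hw; rewrite Csum_S in Hw.
    rewrite Nat.ltb_irrefl, (proj2 (Nat.leb_gt (S n) n)) in Hw by lia.
    replace (_ + _)%X with (inner (S n) w z + C0)%X in Hw; [rewrite <- Hw; ring|].
    f_equal; [|ring]; apply Csum_ext; intros j Hj.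
    rewrite (proj2 (Nat.leb_le j n)) by lia; ring. }
  (* With s = 0, w would be a kernel vector orthogonal to z, hence zero by injectivity. *)
  assert (Hs : s <> C0).
  { intros Hs; destruct Hw0 as (j & Hj & Hwj); apply Hwj.
    destruct (Nat.eq_dec j (S n)) as [->|]; [easy|].
    apply (vnorm_eq0 (S n)); [|lia]; apply Hinj; [easy|].
    intros i Hi; rewrite Hv, Hs by easy; ring. }
  exists (vscal (Cinv s) w); split.
  - unfold orth; rewrite inner_scal_l, Ho; ring.
  - intros i Hi; rewrite Dsys_scal, Hv by easy.
    transitivity ((s * Cinv s) * v i)%X; [ring|rewrite Cinv_r by easy; ring].
Qed.

(** * Angles *)

Lemma dR_ext n u v u' v' :
  (forall j, (j < S n)%nat -> u j = u' j) -> (forall j, (j < S n)%nat -> v j = v' j) ->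
  dR n u v = dR n u' v'.
Proof.
  intros Hu Hv; unfold dR.
  now rewrite (inner_ext _ _ _ _ _ Hu Hv), (vnorm_ext _ _ _ Hu), (vnorm_ext _ _ _ Hv).
Qed.

Lemma Cabs_inner_sym m u v : Cabs (inner m u v) = Cabs (inner m v u).
Proof. now rewrite inner_conj, Cabs_conj. Qed.

Lemma dR_sym n u v : dR n u v = dR n v u.
Proof. unfold dR; now rewrite Cabs_inner_sym, Rmult_comm. Qed.

Lemma dR_scal_r n u v c :
  c <> C0 -> 0 < vnorm (S n) u -> 0 < vnorm (S n) v ->
  dR n u (vscal c v) = dR n u v.
Proof.
  intros Hc Hu Hv; apply Cabs_gt0 in Hc; unfold dR.
  rewrite inner_scal_r, vnorm_scal, Cabs_mul, Cabs_conj; f_equal; field; lra.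
Qed.

Lemma dR_cos n u v :
  0 < vnorm (S n) u -> 0 < vnorm (S n) v ->
  cos (dR n u v) * (vnorm (S n) u * vnorm (S n) v) = Cabs (inner (S n) u v) /\
  -1 <= Cabs (inner (S n) u v) / (vnorm (S n) u * vnorm (S n) v) <= 1.
Proof.
  intros Hu Hv; pose proof (Cabs_inner_le (S n) u v); pose proof (Cabs_ge0 (inner (S n) u v)).
  assert (HP : 0 < vnorm (S n) u * vnorm (S n) v) by now apply Rmult_lt_0_compat.
  set (P := vnorm (S n) u * vnorm (S n) v) in *; set (p := Cabs (inner (S n) u v)) in *.
  assert (-1 <= p / P <= 1).
  { split.
    - apply Rle_trans with 0; [lra|]; apply Rmult_le_pos; [easy|].
      now apply Rlt_le, Rinv_0_lt_compat.
    - apply Rmult_le_reg_r with P; [easy|].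
      replace (p / P * P) with p by (field; lra); lra. }
  split; [|easy]; unfold dR; fold P p; rewrite cos_acos by easy; field; lra.
Qed.

Lemma inner_gt0_of_dR n u v :
  0 < vnorm (S n) u -> 0 < vnorm (S n) v -> dR n u v < PI / 2 ->
  0 < Cabs (inner (S n) u v).
Proof.
  intros Hu Hv H; destruct (dR_cos n u v Hu Hv) as [<- Hb].
  assert (0 <= dR n u v) by apply acos_bound.
  repeat apply Rmult_lt_0_compat; try easy.
  apply cos_gt_0; pose proof PI_RGT_0; lra.
Qed.

(** The tangent is given in squared form without denominators: the right side is the Gram
    determinant that [gram_le] estimates. *)
Lemma tan_dR n u v :
  0 < Cabs (inner (S n) u v) ->
  dR n u v < PI / 2 /\ 0 <= tan (dR n u v) /\
  (tan (dR n u v) * Cabs (inner (S n) u v)) * (tan (dR n u v) * Cabs (inner (S n) u v)) =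
  (vnorm (S n) u * vnorm (S n) u) * (vnorm (S n) v * vnorm (S n) v)
    - Cabs (inner (S n) u v) * Cabs (inner (S n) u v).
Proof.
  intros Hp; pose proof (Cabs_inner_le (S n) u v) as HCS.
  assert (Hu : 0 < vnorm (S n) u)
    by (pose proof (vnorm_ge0 (S n) u); pose proof (vnorm_ge0 (S n) v); nra).
  assert (Hv : 0 < vnorm (S n) v)
    by (pose proof (vnorm_ge0 (S n) u); pose proof (vnorm_ge0 (S n) v); nra).
  destruct (dR_cos n u v Hu Hv) as [E Hb].
  assert (H0 : 0 <= dR n u v) by apply acos_bound.
  assert (HPI : dR n u v <= PI) by apply acos_bound.
  assert (HP : 0 < vnorm (S n) u * vnorm (S n) v) by now apply Rmult_lt_0_compat.
  assert (Hc : 0 < cos (dR n u v)).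
  { apply Rmult_lt_reg_r with (vnorm (S n) u * vnorm (S n) v); lra. }
  assert (Hlt : dR n u v < PI / 2).
  { destruct (Rlt_le_dec (dR n u v) (PI / 2)) as [|Hle]; [easy|].
    pose proof (cos_le_0 (dR n u v)); pose proof PI_RGT_0; lra. }
  pose proof (sin_ge_0 _ H0 HPI) as Hs.
  pose proof (sin2_cos2 (dR n u v)) as Hsc; unfold Rsqr in Hsc.
  split; [easy|]; unfold tan; split.
  - apply Rmult_le_pos; [easy|]; now apply Rlt_le, Rinv_0_lt_compat.
  - rewrite <- E; set (s := sin _) in *; set (c := cos _) in *.
    set (A := vnorm (S n) u) in *; set (B := vnorm (S n) v) in *.
    transitivity (s * s * (A * B * (A * B))); [field; lra|].
    replace (s * s) with (1 - c * c) by lra; ring.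
Qed.

(** The right side minus the left is |<u, u - v>|^2. *)
Lemma gram_le m u v :
  (vnorm m u * vnorm m u) * (vnorm m v * vnorm m v)
    - Cabs (inner m u v) * Cabs (inner m u v) <=
  (vnorm m u * vnorm m u) * (vnorm m (vsub u v) * vnorm m (vsub u v)).
Proof.
  rewrite Cabs_sqr; unfold Cnorm2.
  pose proof (vnorm_add_sqr m u (vscal (- C1)%X v)) as E.
  rewrite inner_scal_r, vnorm_scal, Cabs_opp, Cabs_C1 in E.
  rewrite (vnorm_ext m _ (vsub u v)) in E by (intros; unfold vsub, vadd, vscal; ring).
  replace (fst (Cconj (- C1) * inner m u v)%X) with (- fst (inner m u v)) in E
    by (unfold Cmul, Cconj, Copp, C1; cbn [fst snd]; ring).
  rewrite E; set (A := vnorm m u * vnorm m u).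
  pose proof (Rle_0_sqr (A - fst (inner m u v))) as H1.
  pose proof (Rle_0_sqr (snd (inner m u v))) as H2; unfold Rsqr in *; nra.
Qed.

(** With A the norm of u, |<u, v>| >= A (A - q), while the Gram determinant is at most (A q)^2. *)
Lemma tan_dR_perturb n u v q :
  vnorm (S n) (vsub u v) <= q -> q < vnorm (S n) u ->
  dR n u v < PI / 2 /\ 0 < vnorm (S n) v /\
  0 <= tan (dR n u v) <= q / (vnorm (S n) u - q).
Proof.
  intros Hq Hu; pose proof (vnorm_ge0 (S n) (vsub u v)).
  pose proof (vnorm_le_add_sub (S n) u v).
  set (A := vnorm (S n) u) in *.
  assert (Hp : A * (A - q) <= Cabs (inner (S n) u v)).
  { pose proof (Cabs_triangle (inner (S n) (vsub u v) u) (inner (S n) v u)) as H1.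
    pose proof (Cabs_inner_le (S n) (vsub u v) u) as H2; fold A in H2.
    assert (E : (inner (S n) (vsub u v) u + inner (S n) v u)%X = RtoC (A * A))
      by (rewrite inner_sub_l, inner_self; fold A; ring).
    rewrite E, (Cabs_inner_sym _ v u), Cabs_RtoC, Rabs_pos_eq in H1 by nra; nra. }
  assert (Hp0 : 0 < A * (A - q)) by (apply Rmult_lt_0_compat; lra).
  destruct (tan_dR n u v ltac:(lra)) as (T1 & T2 & T3).
  split; [easy|split; [lra|split; [easy|]]].
  pose proof (gram_le (S n) u v) as G; rewrite <- T3 in G; fold A in G.
  set (t := tan (dR n u v)) in *; set (p := Cabs (inner (S n) u v)) in *.
  assert (H1 : t * p <= A * q).
  { apply le_of_sqr_le; [nra|]; eapply Rle_trans; [apply G|].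
    set (e := vnorm (S n) (vsub u v)) in *.
    replace (A * q * (A * q)) with (A * A * (q * q)) by ring.
    apply Rmult_le_compat_l; nra. }
  assert (H2 : t * (A * (A - q)) <= t * p) by (now apply Rmult_le_compat_l).
  apply Rmult_le_reg_r with (A * (A - q)); [easy|].
  replace (q / (A - q) * (A * (A - q))) with (A * q) by (field; lra); lra.
Qed.

(** [SIN] provides the Taylor polynomial of degree seven, and for a <= 1 its fifth-degree term
    outweighs the seventh-degree one. *)
Lemma sin_ge_cubic a : 0 <= a -> a <= 1 -> a - a * a * a / 6 <= sin a.
Proof.
  intros H0 H1; pose proof PI2_1.
  destruct (SIN a H0 ltac:(lra)) as [Hlb _].
  eapply Rle_trans; [|apply Hlb].
  unfold sin_lb, sin_approx, sin_term; cbn [sum_f_R0 pow Nat.mul Nat.add].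
  cbn [fact Nat.mul Nat.add]; rewrite !INR_IZR_INZ; cbn [Z.of_nat Pos.of_succ_nat Pos.succ].
  assert (0 <= a * a <= 1) by nra.
  assert (Hc : 0 <= a * a * a * (a * a)) by (repeat apply Rmult_le_pos; lra).
  assert (a * a * a * (a * a) * (a * a) <= a * a * a * (a * a)) by nra.
  lra.
Qed.

(* The chart distance dominates the angle because |u| exceeds 1 by enough to
   absorb the cubic error of the sine. *)
Lemma dR_le_chart n u v b e :
  0 < vnorm (S n) v -> vnorm (S n) u * vnorm (S n) u = 1 + b * b ->
  vnorm (S n) (vsub u v) <= e -> e <= b -> b <= 1 -> dR n u v <= e.
Proof.
  intros Hv Hu He Heb Hb; pose proof (vnorm_ge0 (S n) (vsub u v)).
  assert (Hu0 : 0 < vnorm (S n) u) by (pose proof (vnorm_ge0 (S n) u); nra).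
  assert (HPI : e <= PI) by (pose proof PI2_1; lra).
  destruct (dR_cos n u v Hu0 Hv) as [E Hc].
  destruct (Rle_lt_dec (dR n u v) e) as [|Hgt]; [easy|exfalso].
  assert (Hcos : cos (dR n u v) < cos e).
  { apply cos_decreasing_1; try lra; apply acos_bound. }
  pose proof (Cabs_ge0 (inner (S n) u v)) as Hp.
  assert (Hc0 : 0 <= cos (dR n u v)).
  { apply Rmult_le_reg_r with (vnorm (S n) u * vnorm (S n) v); [|lra].
    now apply Rmult_lt_0_compat. }
  pose proof (gram_le (S n) v u) as G.
  rewrite (Cabs_inner_sym _ v u), vnorm_sub_sym, <- E, Hu in G.
  set (B := vnorm (S n) v) in *; set (A := vnorm (S n) u) in *.
  set (c := cos (dR n u v)) in *; set (k := vnorm (S n) (vsub u v)) in *.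
  replace (c * (A * B) * (c * (A * B))) with (B * B * ((A * A) * (c * c))) in G by ring.
  rewrite Hu in G.
  (* The sine of the angle times the length of u is at most the chart distance. *)
  assert (G' : (1 + b * b) * (1 - c * c) <= e * e).
  { apply Rmult_le_reg_l with (B * B); [nra|].
    apply Rle_trans with (B * B * (k * k)); [lra|].
    apply Rmult_le_compat_l; nra. }
  pose proof (sin_ge_cubic e ltac:(lra) ltac:(lra)) as Hs.
  pose proof (sin2_cos2 e) as Hsc; unfold Rsqr in Hsc.
  assert (H1 : 1 - c * c > sin e * sin e) by nra.
  assert (He2 : 0 <= e * e <= 1) by nra.
  assert (H2 : e * e * (1 - e * e / 3) <= sin e * sin e).
  { apply Rle_trans with ((e - e * e * e / 6) * (e - e * e * e / 6)).
    - replace (_ * (e - _)) with (e * e * (1 - e * e / 3) + e * e * (e * e * (e * e)) / 36)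
        by field.
      assert (0 <= e * e * (e * e * (e * e))) by (repeat apply Rmult_le_pos; lra).
      lra.
    - assert (0 <= e - e * e * e / 6) by nra.
      apply Rmult_le_compat; easy. }
  assert (H3 : e * e * ((1 - e * e / 3) * (1 + b * b)) < e * e).
  { apply Rlt_le_trans with ((1 + b * b) * (1 - c * c)); [|easy].
    apply Rle_lt_trans with ((1 + b * b) * (sin e * sin e)); [|nra].
    replace (_ * (_ * (1 + b * b))) with ((1 + b * b) * (e * e * (1 - e * e / 3))) by ring.
    apply Rmult_le_compat_l; nra. }
  (* (1 - b^2/3)(1 + b^2) = 1 + b^2 (2 - b^2)/3, and e <= b allows replacing e by b. *)
  assert (H4 : 1 <= (1 - e * e / 3) * (1 + b * b)).
  { apply Rle_trans with ((1 - b * b / 3) * (1 + b * b)); nra. }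
  nra.
Qed.

(** * Newton's method near a well-conditioned unit vector *)

Section UnitPoint.

Variables (n : nat) (d : nat -> nat) (f : system) (X : Cvec) (op : R) (D : nat).

(** In the application [op] is the operator norm inside mu, so [mu1] is mu; [g] is then the gamma of
    the overview, since D^(3/2) = D sqrt D. *)
Let mu1 := BWnorm n d f * op.
Let M := mu1 * sqrt (INR D).
Let g := INR D * M / 2.

Hypothesis X_unit : vnorm (S n) X = 1.
Hypothesis d_range : forall i, (i < n)%nat -> (1 <= d i <= D)%nat.
Hypothesis op_gt0 : 0 < op.
Hypothesis op_spec : forall v, orth n v X ->
  vnorm (S n) v <= op * wnorm n d (Dsys n d f X v).
Hypothesis M_ge1 : 1 <= M.

Lemma BWnorm_gt0 : 0 < BWnorm n d f.
Proof.
  assert (H : 0 <= BWnorm n d f) by apply sqrt_pos.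
  destruct H as [|E]; [easy|].
  unfold M, mu1 in M_ge1; rewrite <- E in M_ge1; lra.
Qed.

(** Reduces a bound on the system to scalar inequalities, one per degree: the norms of the
    components add up in square to [BWnorm], which together with [op] makes mu. *)
Lemma op_wnorm_bound r (Bi : nat -> R) B :
  0 <= B ->
  (forall i, (i < n)%nat -> Cabs (r i) <= pnorm (S n) (d i) (f i) * Bi i) ->
  (forall i, (i < n)%nat -> mu1 / sqrt (INR (d i)) * Bi i <= B) ->
  op * wnorm n d r <= B.
Proof.
  intros HB Hr Hi; pose proof BWnorm_gt0.
  assert (Hmu : 0 < mu1) by (unfold mu1; nra).
  assert (HW : wnorm n d r <= BWnorm n d f * (B / mu1)).
  { apply wnorm_bound.
    - intros i H0; now apply d_range.
    - apply Rmult_le_pos; [easy|]; now apply Rlt_le, Rinv_0_lt_compat.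
    - intros i H0; eapply Rle_trans; [now apply Hr|].
      apply Rmult_le_compat_l; [apply pnorm_ge0|].
      assert (0 < sqrt (INR (d i))) by (apply sqrt_lt_R0, lt_0_INR, d_range, H0).
      apply Rmult_le_reg_l with (mu1 / sqrt (INR (d i)));
        [now apply Rdiv_lt_0_compat|].
      eapply Rle_trans; [now apply Hi|]; apply Req_le; field; lra. }
  apply Rle_trans with (op * (BWnorm n d f * (B / mu1)));
    [apply Rmult_le_compat_l; lra|].
  apply Req_le; unfold mu1; field; lra.
Qed.

Lemma mu1_sqrt_degree i :
  (i < n)%nat -> 0 <= mu1 / sqrt (INR (d i)) /\ mu1 / sqrt (INR (d i)) * INR (d i) <= M.
Proof.
  intros Hi; pose proof BWnorm_gt0; destruct (d_range i Hi) as [H1 H2].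
  assert (Hmu : 0 < mu1) by (unfold mu1; nra).
  assert (Hp : 0 < INR (d i)) by (apply lt_0_INR; lia).
  assert (0 < sqrt (INR (d i))) by (now apply sqrt_lt_R0).
  split; [now apply Rlt_le, Rdiv_lt_0_compat|].
  replace (_ * INR (d i)) with (mu1 * sqrt (INR (d i)))
    by (rewrite <- (sqrt_sqrt (INR (d i))) at 3 by lra; field; lra).
  apply Rmult_le_compat_l; [lra|]; apply sqrt_le_1_alt, le_INR; easy.
Qed.

Lemma g_ge : (2 <= D)%nat -> 1 <= g.
Proof. intros H; apply (le_INR 2) in H; cbn in H; unfold g; nra. Qed.

Lemma g_ge0 : 0 <= g.
Proof. pose proof (pos_INR D); unfold g; nra. Qed.

Lemma growth_ge0 R1 : 0 <= R1 -> g * R1 < 1 -> 0 <= / ((1 - g * R1) * (1 - g * R1)) - 1.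
Proof.
  intros H0 H1; pose proof g_ge0.
  assert (0 <= g * R1) by nra.
  enough (/ 1 <= / ((1 - g * R1) * (1 - g * R1))) by lra.
  apply Rinv_le_contravar; nra.
Qed.

(** Because 1 <= s' and s <= 1 + R1, the difference of the powers of s and s' is at most that of 1 +
    R1 and 1, to which [pow_growth] applies. *)
Lemma Dsys_lipschitz z z' s s' R1 v :
  vnorm (S n) z <= s -> vnorm (S n) z' <= s' -> vnorm (S n) (vsub z z') <= s - s' ->
  1 <= s' -> s <= 1 + R1 -> g * R1 < 1 ->
  op * wnorm n d (vsub (Dsys n d f z v) (Dsys n d f z' v)) <=
  (/ ((1 - g * R1) * (1 - g * R1)) - 1) * vnorm (S n) v.
Proof.
  intros Hs Hs' Hss H1 HR Hg.
  pose proof (vnorm_ge0 (S n) (vsub z z')); pose proof (vnorm_ge0 (S n) v).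
  pose proof (growth_ge0 R1 ltac:(lra) Hg).
  apply op_wnorm_bound with (Bi := fun i =>
    INR (d i) * (s ^ (d i - 1) - s' ^ (d i - 1)) * vnorm (S n) v).
  - apply Rmult_le_pos; easy.
  - intros i Hi; now apply pdiff_lipschitz.
  - intros i Hi; destruct (mu1_sqrt_degree i Hi) as [E1 E2].
    rewrite <- !Rmult_assoc; apply Rmult_le_compat_r; [easy|].
    apply Rle_trans with (M * ((1 + R1) ^ (d i - 1) - 1)).
    + pose proof (pow_R1_Rle s' (d i - 1) H1).
      pose proof (pow_le_pow (d i - 1) (1 + R1) s ltac:(lra) HR).
      pose proof (pow_le_pow (d i - 1) s s' ltac:(lra) ltac:(lra)).
      pose proof (pos_INR (d i)).
      apply Rmult_le_compat; [|lra|easy|lra].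
      apply Rmult_le_pos; easy.
    + apply pow_growth; try apply d_range; try easy; lra.
Qed.

Lemma taylor_majorized z z' t t' b :
  vnorm (S n) (vsub z X) <= t -> vnorm (S n) (vsub z' X) <= t' ->
  vnorm (S n) (vsub z z') <= t - t' -> g * t < 1 ->
  op * wnorm n d (vsub (vsub (sys_eval n d f z) (sys_eval n d f z'))
                       (Dsys n d f X (vsub z z'))) <=
  smale_majorant b g t - smale_majorant b g t'.
Proof.
  intros Ht Ht' Htt Hg.
  pose proof (vnorm_ge0 (S n) (vsub z z')); pose proof (vnorm_ge0 (S n) (vsub z' X)).
  apply op_wnorm_bound with (Bi := fun i =>
    (1 + t) ^ d i - (1 + t') ^ d i - INR (d i) * 1 ^ (d i - 1) * (t - t')).
  - pose proof (majorant_mono b g t t' g_ge0); lra.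
  - intros i Hi; apply peval_taylor; lra.
  - intros i Hi; destruct (mu1_sqrt_degree i Hi) as [E1 E2].
    rewrite pow1, Rmult_1_r; unfold smale_majorant.
    replace (b + _ - _) with (g * (t * t) / (1 - g * t) - g * (t' * t') / (1 - g * t'))
      by ring.
    apply majorant_diff; try apply d_range; try easy; lra.
Qed.

(** Here the derivative is taken at z, whose norm need not be 1, so [pow_second_order] takes the
    place of the majorant based at a unit vector. The coefficient mu / sqrt(d_i) times d_i (d_i -
    1)/2 is at most [g]. *)
Lemma second_order_bound z b L :
  vnorm (S n) z + vnorm (S n) b <= 1 + L -> 0 <= L -> g * L < 1 ->
  op * wnorm n d (vsub (vsub (sys_eval n d f (vadd z b)) (sys_eval n d f z))
                       (Dsys n d f z b)) <=
  g * / ((1 - g * L) * (1 - g * L)) * (vnorm (S n) b * vnorm (S n) b).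
Proof.
  intros HL HL0 Hg; set (r := vnorm (S n) z) in *; set (e := vnorm (S n) b) in *.
  assert (Hr : 0 <= r) by apply vnorm_ge0; assert (He : 0 <= e) by apply vnorm_ge0.
  pose proof (growth_ge0 L HL0 Hg); pose proof g_ge0.
  assert (Eb : forall j, (j < S n)%nat -> vsub (vadd z b) z j = b j)
    by (intros; unfold vsub, vadd; ring).
  apply op_wnorm_bound with (Bi := fun i =>
    (r + e) ^ d i - (r + 0) ^ d i - INR (d i) * r ^ (d i - 1) * (e - 0)).
  - apply Rmult_le_pos; [|nra]; apply Rmult_le_pos; lra.
  - intros i Hi; unfold vsub at 1 2.
    rewrite <- (Dsys_ext n d f z _ b i Eb), Dsys_pdiff.
    apply peval_taylor; fold r.
    + lra.
    + rewrite (vnorm_ext _ _ b Eb); fold e; lra.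
    + rewrite vnorm_zero; [lra|intros; unfold vsub; ring].
    + rewrite (vnorm_ext _ _ b Eb); fold e; lra.
  - intros i Hi; destruct (mu1_sqrt_degree i Hi) as [E1 E2].
    rewrite Rplus_0_r, Rminus_0_r.
    pose proof (pow_second_order (d i) r e (1 + L) Hr He HL ltac:(lra)) as HP.
    assert (Hgr : (1 + L) ^ (d i - 1) <= / ((1 - g * L) * (1 - g * L))).
    { pose proof (pow_growth (d i) D M L (proj1 (d_range i Hi)) (proj2 (d_range i Hi))
        M_ge1 HL0 Hg) as HG.
      pose proof (pow_R1_Rle (1 + L) (d i - 1) ltac:(lra)).
      fold g in HG; nra. }
    assert (H1d : 1 <= INR (d i)) by (apply (le_INR 1), d_range; easy).
    assert (HdD : INR (d i) <= INR D) by (apply le_INR, d_range; easy).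
    pose proof (pow_R1_Rle (1 + L) (d i - 1) ltac:(lra)).
    eapply Rle_trans; [apply Rmult_le_compat_l; [easy|apply HP]|].
    replace (_ * (_ * _ * (e * e))) with
      (mu1 / sqrt (INR (d i)) * INR (d i) * ((INR (d i) - 1) / 2)
        * (1 + L) ^ (d i - 1) * (e * e))
      by (field; apply Rgt_not_eq, sqrt_lt_R0; lra).
    apply Rmult_le_compat_r; [nra|].
    apply Rmult_le_compat; [|lra| |easy].
    + apply Rmult_le_pos; [apply Rmult_le_pos; lra|lra].
    + unfold g; apply Rle_trans with (M * (INR D / 2)); [|lra].
      apply Rmult_le_compat; [apply Rmult_le_pos; lra|lra|easy|lra].
Qed.

(** * One Newton step near a zero in the chart *)

Section OneStep.

Variable a : Cvec.
Let zeta := vadd X a.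
Let ta := vnorm (S n) a.

Hypothesis D_ge2 : (2 <= D)%nat.
Hypothesis a_orth : orth n a X.
Hypothesis zeta_zero : is_zero n d f zeta.
Hypothesis ta_small : g * ta <= 52 / 1000.

Lemma ta_bounds : 0 <= ta <= 52 / 1000.
Proof.
  split; [apply vnorm_ge0|].
  pose proof (g_ge D_ge2); assert (0 <= ta) by apply vnorm_ge0; nra.
Qed.

Lemma zeta_norm_sqr : vnorm (S n) zeta * vnorm (S n) zeta = 1 + ta * ta.
Proof.
  unfold zeta; rewrite vnorm_add_sqr, inner_conj, (a_orth : inner _ _ _ = C0), X_unit.
  unfold Cconj, C0; cbn [fst snd]; fold ta; ring.
Qed.

Lemma zeta_norm : 1 <= vnorm (S n) zeta <= 101 / 100 /\ vnorm (S n) zeta <= 1 + ta.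
Proof.
  pose proof zeta_norm_sqr; pose proof ta_bounds; pose proof (vnorm_ge0 (S n) zeta).
  repeat split; apply le_of_sqr_le; nra.
Qed.

Lemma inner_zeta_X : inner (S n) zeta X = C1.
Proof.
  unfold zeta; rewrite inner_add_l, inner_self, X_unit, (a_orth : inner _ _ _ = C0).
  rewrite Rmult_1_r; change (RtoC 1) with C1; ring.
Qed.

Lemma growth_small R1 :
  0 <= R1 -> R1 <= 201 / 100 * ta ->
  g * R1 < 1 /\ / ((1 - g * R1) * (1 - g * R1)) - 1 <= 1 / 4.
Proof.
  intros H0 H1; pose proof (g_ge D_ge2).
  (* 2.01 times 0.052; the square of 1 - 0.10452 still exceeds 4/5. *)
  assert (H2 : g * R1 <= 10452 / 100000) by nra.
  split; [lra|].
  enough (/ ((1 - g * R1) * (1 - g * R1)) <= / (4 / 5)) by lra.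
  apply Rinv_le_contravar; nra.
Qed.

Section Scaled.

Variables z b : Cvec.
Hypothesis zeta_split : forall j, zeta j = (z j + b j)%X.
Hypothesis b_orth : orth n b z.
Hypothesis b_small : vnorm (S n) b <= 101 / 100 * ta.

(** Pythagoras: z is the orthogonal projection of zeta onto the line of the current iterate, so |b|
    / |z| is the tangent distance. *)
Lemma z_norm_sqr :
  vnorm (S n) z * vnorm (S n) z + vnorm (S n) b * vnorm (S n) b =
  vnorm (S n) zeta * vnorm (S n) zeta.
Proof.
  rewrite (vnorm_ext _ zeta (vadd z b)) by (intros; apply zeta_split).
  rewrite vnorm_add_sqr, inner_conj, (b_orth : inner _ _ _ = C0).
  unfold Cconj, C0; cbn [fst snd]; ring.
Qed.

Lemma z_norm_le : vnorm (S n) z <= vnorm (S n) zeta.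
Proof.
  pose proof z_norm_sqr; pose proof (vnorm_ge0 (S n) zeta).
  apply le_of_sqr_le; [easy|]; pose proof (vnorm_ge0 (S n) b); nra.
Qed.

(* Subtracting a multiple of zeta moves v from the complement of z to that of X
   without changing Df(zeta) v, since Df(zeta) zeta = 0 by Euler's identity. *)
Lemma Dsys_lower_bound v :
  orth n v z -> 41 / 100 * vnorm (S n) v <= op * wnorm n d (Dsys n d f z v).
Proof.
  intros Hv; set (e := inner (S n) v X); set (v' := vsub v (vscal e zeta)).
  pose proof zeta_norm as ((Hz1 & Hz2) & Hz3); pose proof ta_bounds.
  pose proof (vnorm_ge0 (S n) v); pose proof (vnorm_ge0 (S n) b).
  set (R1 := ta + vnorm (S n) b).
  destruct (growth_small R1) as [HgR Hk]; [unfold R1; lra|unfold R1; lra|].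
  (* v is orthogonal to z and X = z + (b - a), hence <v, X> = <v, b - a>. *)
  assert (He : Cabs e <= vnorm (S n) v * R1).
  { replace e with (inner (S n) v (vsub b a)).
    - eapply Rle_trans; [apply Cabs_inner_le|]; apply Rmult_le_compat_l; [easy|].
      pose proof (vnorm_sub_le (S n) b a) as Hsub; fold ta in Hsub; unfold R1; lra.
    - unfold e; rewrite (inner_ext _ v X v (vadd z (vsub b a))).
      + rewrite inner_add_r, (Hv : inner _ _ _ = C0); ring.
      + easy.
      + intros j _; unfold vadd, vsub.
        replace (X j) with (zeta j - a j)%X by (unfold zeta, vadd; ring).
        rewrite zeta_split; ring. }
  assert (Hv' : orth n v' X).
  { unfold orth, v'; rewrite inner_sub_l, inner_scal_l, inner_zeta_X; fold e; ring. }
  (* 1 - 1.01 R1 > 0.89, as R1 <= 0.10452. *)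
  assert (Hn : 89 / 100 * vnorm (S n) v <= vnorm (S n) v').
  { pose proof (vnorm_le_add_sub (S n) v v') as Hvv.
    rewrite (vnorm_ext _ (vsub v v') (vscal e zeta)) in Hvv
      by (intros; unfold v', vsub, vscal; ring).
    rewrite vnorm_scal in Hvv.
    assert (Cabs e * vnorm (S n) zeta <= vnorm (S n) v * R1 * (101 / 100))
      by (apply Rmult_le_compat; [apply Cabs_ge0|lra|easy|lra]).
    assert (R1 <= 10452 / 100000) by (unfold R1; lra).
    nra. }
  assert (Hz : forall i, (i < n)%nat -> Dsys n d f zeta v' i = Dsys n d f zeta v i).
  { intros i Hi; unfold v'; rewrite Dsys_sub, Dsys_scal, Dsys_euler, zeta_zero by easy; ring. }
  pose proof (op_spec v' Hv') as Hop.
  assert (HW : wnorm n d (Dsys n d f X v') <=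
    wnorm n d (Dsys n d f z v) +
    wnorm n d (vsub (Dsys n d f z v) (Dsys n d f zeta v)) +
    wnorm n d (vsub (Dsys n d f zeta v') (Dsys n d f X v'))).
  { rewrite (wnorm_sub_sym n d (Dsys n d f z v)), (wnorm_sub_sym n d (Dsys n d f zeta v')).
    eapply Rle_trans; [|apply Rplus_le_compat_r, wnorm_triangle].
    eapply Rle_trans; [|apply wnorm_triangle].
    apply Req_le, wnorm_ext; intros i Hi; unfold vadd, vsub; rewrite Hz by easy; ring. }
  assert (L1 : op * wnorm n d (vsub (Dsys n d f z v) (Dsys n d f zeta v)) <=
    (/ ((1 - g * R1) * (1 - g * R1)) - 1) * vnorm (S n) v).
  { assert (E : vnorm (S n) (vsub z zeta) = vnorm (S n) b).
    { rewrite vnorm_sub_sym; apply vnorm_ext; intros; unfold vsub.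
      rewrite zeta_split; ring. }
    pose proof (vnorm_le_add_sub (S n) z zeta).
    apply Dsys_lipschitz with (s := 1 + ta + vnorm (S n) b) (s' := 1 + ta);
      unfold R1 in *; lra. }
  assert (L2 : op * wnorm n d (vsub (Dsys n d f zeta v') (Dsys n d f X v')) <=
    (/ ((1 - g * R1) * (1 - g * R1)) - 1) * vnorm (S n) v').
  { apply Dsys_lipschitz with (s := 1 + ta) (s' := 1); try (unfold R1 in *; lra).
    rewrite (vnorm_ext _ _ a); [fold ta; lra|].
    intros; unfold zeta, vsub, vadd; ring. }
  assert (L3 : op * wnorm n d (Dsys n d f X v') <= op * wnorm n d (Dsys n d f z v) +
    op * wnorm n d (vsub (Dsys n d f z v) (Dsys n d f zeta v)) +
    op * wnorm n d (vsub (Dsys n d f zeta v') (Dsys n d f X v')))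
    by (rewrite <- !Rmult_plus_distr_l; apply Rmult_le_compat_l; lra).
  set (k := / ((1 - g * R1) * (1 - g * R1)) - 1) in *.
  (* The two Lipschitz terms cost a quarter of |v| and a quarter of |v'|; what remains is at least
     0.75 * 0.89 - 0.25 > 0.41 times |v|. *)
  assert (k * vnorm (S n) v <= 1 / 4 * vnorm (S n) v) by (apply Rmult_le_compat_r; lra).
  assert (k * vnorm (S n) v' <= 1 / 4 * vnorm (S n) v')
    by (apply Rmult_le_compat_r; [apply vnorm_ge0|lra]).
  lra.
Qed.

(** w + b is the vector from the Newton point z - w to zeta. As f(zeta) = 0 and Df(z) w = f(z), its
    image under Df(z) is minus the second-order remainder at z. The constant is 1.25 / 0.41 rounded
    up. *)
Lemma newton_error w :
  newton_corr n d f z w ->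
  vnorm (S n) (vadd w b) <= 305 / 100 * g * (vnorm (S n) b * vnorm (S n) b).
Proof.
  intros [Ho Hs]; pose proof zeta_norm as ((Hz1 & Hz2) & Hz3); pose proof ta_bounds.
  pose proof (g_ge D_ge2); pose proof (vnorm_ge0 (S n) b).
  assert (Hq : orth n (vadd w b) z).
  { unfold orth in *; rewrite inner_add_l, Ho, b_orth; ring. }
  pose proof (Dsys_lower_bound _ Hq) as HL.
  set (L := 201 / 100 * ta).
  destruct (growth_small L) as [HgR Hk]; [unfold L; lra|unfold L; lra|].
  pose proof z_norm_le.
  pose proof (second_order_bound z b L ltac:(unfold L; lra) ltac:(unfold L; lra) HgR) as HS.
  assert (E : wnorm n d (Dsys n d f z (vadd w b)) =
    wnorm n d (vsub (vsub (sys_eval n d f (vadd z b)) (sys_eval n d f z))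
                       (Dsys n d f z b))).
  { transitivity (wnorm n d (vsub (fun _ => C0) (Dsys n d f z (vadd w b)))).
    - rewrite wnorm_sub_sym; apply wnorm_ext; intros; unfold vsub; ring.
    - apply wnorm_ext; intros i Hi; unfold vsub at 1 2 3.
      rewrite Dsys_add, Hs by easy.
      replace (sys_eval n d f (vadd z b) i) with C0; [ring|].
      rewrite <- (zeta_zero i Hi); apply peval_ext; intros; apply zeta_split. }
  rewrite E in HL; set (q := vnorm (S n) (vadd w b)) in *.
  set (e := vnorm (S n) b) in *; set (k := / _) in *.
  assert (g * k * (e * e) <= g * (5 / 4) * (e * e)).
  { apply Rmult_le_compat_r; [nra|]; apply Rmult_le_compat_l; lra. }
  assert (0 <= g * (e * e)) by (apply Rmult_le_pos; nra).
  lra.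
Qed.

End Scaled.

Lemma newton_one_step z0 :
  vnonzero (S n) z0 -> dR n zeta z0 < PI / 2 -> tan (dR n zeta z0) <= ta ->
  rank_full n d f z0 /\
  forall w0 y0, newton_corr n d f z0 w0 ->
    (forall j, (j <= n)%nat -> y0 j = Csub (z0 j) (w0 j)) ->
    vnonzero (S n) y0 /\ dR n zeta y0 < PI / 2 /\
    0 <= tan (dR n zeta y0) <= 4 * g * (tan (dR n zeta z0) * tan (dR n zeta z0)).
Proof.
  intros Hnz HdR Htan; pose proof zeta_norm as ((Hz1 & Hz2) & Hz3).
  pose proof ta_bounds; pose proof (g_ge D_ge2).
  pose proof (vnorm_gt0 _ _ Hnz) as Hr.
  pose proof (inner_gt0_of_dR n zeta z0 ltac:(lra) Hr HdR) as Hp.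
  destruct (tan_dR n zeta z0 Hp) as (_ & Ht0 & Ht2).
  set (t := tan (dR n zeta z0)) in *; set (p := Cabs (inner (S n) zeta z0)) in *.
  set (r := vnorm (S n) z0) in *.
  (* The coefficient of the orthogonal projection of zeta onto the line of z0. *)
  set (l := (inner (S n) zeta z0 * RtoC (/ (r * r)))%X).
  assert (Hrr : 0 < / (r * r)) by (apply Rinv_0_lt_compat; nra).
  assert (El : Cabs l = p / (r * r))
    by (unfold l; rewrite Cabs_mul, Cabs_RtoC, Rabs_pos_eq by lra; easy).
  assert (Hl : l <> C0).
  { intros E; rewrite E, Cabs_C0 in El.
    assert (0 < p / (r * r)) by (apply Rmult_lt_0_compat; easy); lra. }
  set (z := vscal l z0); set (b := vsub zeta z).
  assert (Hsplit : forall j, zeta j = (z j + b j)%X) by (intros; unfold b, vsub; ring).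
  assert (Hb0 : inner (S n) b z0 = C0).
  { unfold b, z; rewrite inner_sub_l, inner_scal_l, inner_self; fold r; unfold l.
    transitivity (inner (S n) zeta z0 *
      (C1 - RtoC (/ (r * r)) * RtoC (r * r)))%X; [ring|].
    rewrite <- RtoC_mul, Rinv_l by nra; change (RtoC 1) with C1; ring. }
  assert (Hb : orth n b z).
  { unfold orth, z; rewrite inner_scal_r, Hb0; ring. }
  assert (Ez : vnorm (S n) z = p / r)
    by (unfold z; rewrite vnorm_scal, El; fold r; field; lra).
  pose proof (z_norm_sqr z b Hsplit Hb) as Hpyth.
  pose proof (z_norm_le z b Hsplit Hb) as Hzle.
  pose proof (vnorm_ge0 (S n) z) as Hz0; pose proof (vnorm_ge0 (S n) b) as Hbn0.
  assert (Ebn : vnorm (S n) b = t * vnorm (S n) z).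
  { assert (Htz : 0 <= t * vnorm (S n) z) by (apply Rmult_le_pos; easy).
    assert (E : vnorm (S n) b * vnorm (S n) b =
      t * vnorm (S n) z * (t * vnorm (S n) z)).
    { rewrite Ez in *; apply Rmult_eq_reg_r with (r * r); [|nra].
      replace (t * (p / r) * (t * (p / r)) * (r * r)) with (t * p * (t * p))
        by (field; lra).
      rewrite Ht2, <- Hpyth; field; lra. }
    apply Rle_antisym; apply le_of_sqr_le; lra. }
  assert (Hbs : vnorm (S n) b <= 101 / 100 * ta).
  { rewrite Ebn; nra. }
  split.
  - apply rank_full_of_injective; intros v Hv HD0.
    pose proof (Dsys_lower_bound z b Hsplit Hbs v) as HL.
    assert (Hvz : orth n v z).
    { unfold orth, z in *; rewrite inner_scal_r, Hv; ring. }
    specialize (HL Hvz).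
    assert (HW : wnorm n d (Dsys n d f z v) = 0).
    { apply vnorm_zero; intros i Hi; unfold z; rewrite Dsys_scal_base, HD0 by easy; ring. }
    rewrite HW in HL; pose proof (vnorm_ge0 (S n) v); lra.
  - intros w0 y0 [Ho Hs] Hy.
    set (w := vscal l w0).
    (* Newton's map commutes with scaling, so the projected representative z may replace z0. *)
    assert (Hw : newton_corr n d f z w).
    { split.
      - unfold orth, z, w in *; rewrite inner_scal_r, inner_scal_l, Ho; ring.
      - intros i Hi; unfold z, w; rewrite Dsys_scal_base, Dsys_scal, sys_eval_scal, Hs by easy.
        destruct (d_range i Hi) as [Hdi _]; replace (d i) with (S (d i - 1)) at 2 by lia.
        cbn [Cpow]; ring. }
    pose proof (newton_error z b Hsplit Hb Hbs w Hw) as Hq.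
    set (q := vnorm (S n) (vadd w b)) in *.
    (* 3.05 |z|^2 <= 3.05 (1 + ta^2) < 3.1. *)
    assert (Hq' : q <= 31 / 10 * (g * (t * t))).
    { eapply Rle_trans; [apply Hq|]; rewrite Ebn.
      replace (305 / 100 * g * _) with
        (305 / 100 * (g * (t * t)) * (vnorm (S n) z * vnorm (S n) z)) by ring.
      assert (vnorm (S n) z * vnorm (S n) z <= 1003 / 1000)
        by (pose proof zeta_norm_sqr; nra).
      assert (0 <= g * (t * t)) by (apply Rmult_le_pos; nra).
      nra. }
    assert (Hgt : g * (t * t) <= 3 / 1000).
    { assert (g * t <= 52 / 1000) by nra; nra. }
    assert (HN : vnorm (S n) (vsub zeta (vscal l y0)) <= q).
    { apply Req_le, vnorm_ext; intros j Hj; unfold vsub, vadd, vscal.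
      rewrite Hy, Hsplit by lia; unfold z, w, vscal; ring. }
    assert (Hq0 : 0 <= q) by apply vnorm_ge0.
    destruct (tan_dR_perturb n zeta (vscal l y0) q HN ltac:(lra)) as (P1 & P2 & P3 & P4).
    rewrite vnorm_scal in P2.
    assert (Hy0 : 0 < vnorm (S n) y0).
    { pose proof (vnorm_ge0 (S n) y0) as [|E]; [easy|]; rewrite <- E in P2; lra. }
    rewrite dR_scal_r in P1, P3, P4 by (try easy; lra).
    split; [now apply vnonzero_of_vnorm|split; [easy|split; [easy|]]].
    eapply Rle_trans; [apply P4|].
    apply Rmult_le_reg_r with (vnorm (S n) zeta - q); [lra|].
    replace (q / (vnorm (S n) zeta - q) * (vnorm (S n) zeta - q)) with q by (field; lra).
    assert (0 <= g * (t * t)) by (apply Rmult_le_pos; nra).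
    (* q <= 3.1 * 0.003 keeps |zeta| - q above 0.99, and 3.1 < 4 * 0.99. *)
    apply Rle_trans with (4 * g * (t * t) * (99 / 100)); [lra|].
    apply Rmult_le_compat_l; lra.
Qed.

Lemma approx_zero_near z0 :
  vnonzero (S n) z0 -> dR n zeta z0 < PI / 2 -> tan (dR n zeta z0) <= ta ->
  approx_zero n d f z0 zeta.
Proof.
  intros Hnz HdR Htan; pose proof zeta_norm as ((Hz1 & Hz2) & Hz3).
  pose proof ta_bounds; pose proof (g_ge D_ge2).
  split; [easy|split; [apply vnonzero_of_vnorm; lra|split; [easy|]]].
  (* A Newton step exists only for points close to zeta; [epsilon] makes a total map that can be
     iterated, and the invariant [Inv] keeps the iterates where it is a genuine step. *)
  set (next := fun z => epsilon (inhabits z) (newton_step n d f z)).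
  exists (fun p => Nat.iter p next z0); split; [easy|].
  set (t0 := tan (dR n zeta z0)) in *.
  assert (Ht0 : 0 <= t0).
  { apply tan_dR, inner_gt0_of_dR; [lra|now apply vnorm_gt0|easy]. }
  assert (Hhalf : forall k, 0 <= (1 / 2) ^ k <= 1).
  { intros k; split; [apply pow_le; lra|].
    apply Rle_trans with (1 ^ k); [apply pow_incr; lra|rewrite pow1; lra]. }
  assert (Hnext : forall z, vnonzero (S n) z -> dR n zeta z < PI / 2 ->
    tan (dR n zeta z) <= ta -> newton_step n d f z (next z)).
  { intros z Hz1' Hz2' Hz3'; apply epsilon_spec.
    destruct (newton_one_step z Hz1' Hz2' Hz3') as [Hrk _].
    destruct (Hrk (sys_eval n d f z)) as (w & Hw).
    exists (vsub z w); split; [easy|split; [easy|]]; exists w; split; easy. }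
  assert (Inv : forall p, let z := Nat.iter p next z0 in
    vnonzero (S n) z /\ dR n zeta z < PI / 2 /\
    0 <= tan (dR n zeta z) <= (1 / 2) ^ (2 ^ p - 1) * t0).
  { induction p as [|p IH].
    - cbn [Nat.iter nat_rect Nat.pow Nat.sub pow]; fold t0; repeat split; try easy; lra.
    - cbn [Nat.iter nat_rect]; set (z := Nat.iter p next z0) in *.
      destruct IH as (I1 & I2 & I3 & I4); specialize (Hhalf (2 ^ p - 1)%nat).
      assert (I5 : tan (dR n zeta z) <= ta) by nra.
      destruct (Hnext z I1 I2 I5) as (_ & _ & w & Hw & Hy).
      destruct (newton_one_step z I1 I2 I5) as [_ Hstep].
      destruct (Hstep w (next z) Hw Hy) as (J1 & J2 & J3 & J4).
      change (nat_rect (fun _ => Cvec) z0 (fun _ => next) p) with z.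
      repeat split; try easy.
      eapply Rle_trans; [apply J4|].
      set (h := (1 / 2) ^ (2 ^ p - 1)) in *.
      assert (E : (1 / 2) ^ (2 ^ S p - 1) = h * h * (1 / 2)).
      { replace (2 ^ S p - 1)%nat with ((2 ^ p - 1) + (2 ^ p - 1) + 1)%nat
          by (pose proof (Nat.pow_nonzero 2 p ltac:(lia)); cbn [Nat.pow]; lia).
        rewrite !pow_add, pow_1; reflexivity. }
      rewrite E; set (t := tan (dR n zeta z)) in *.
      assert (t * t <= h * t0 * (h * t0)) by (apply Rmult_le_compat; lra).
      (* This supplies the extra half in 2^(p+1) - 1 = 2 (2^p - 1) + 1. *)
      assert (4 * g * t0 <= 1 / 2) by nra.
      assert (0 <= h * h * t0) by (apply Rmult_le_pos; nra).
      apply Rle_trans with (4 * g * (h * t0 * (h * t0))).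
      + apply Rmult_le_compat_l; lra.
      + replace (4 * g * (h * t0 * (h * t0))) with (h * h * t0 * (4 * g * t0)) by ring.
        replace (h * h * (1 / 2) * t0) with (h * h * t0 * (1 / 2)) by ring.
        now apply Rmult_le_compat_l. }
  intros p; destruct (Inv p) as (I1 & I2 & I3 & I4).
  specialize (Hhalf (2 ^ p - 1)%nat); split.
  - apply (Hnext (Nat.iter p next z0)); try easy; nra.
  - split; easy.
Qed.

End OneStep.

(** * The chord iteration and its limit *)

Hypothesis X_rank : rank_full n d f X.

Let sol (v : Cvec) : Cvec := proj1_sig (constructive_indefinite_description _ (X_rank v)).

Lemma sol_spec v : Dsolves n d f X v (sol v).
Proof. unfold sol; apply proj2_sig. Qed.

(** Iterates are stored as displacements from X, so that they lie in its orthogonal complement. *)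
Fixpoint chord_iter (k : nat) : Cvec :=
  match k with
  | O => fun _ => C0
  | S k' => vsub (chord_iter k') (sol (sys_eval n d f (vadd X (chord_iter k'))))
  end.

Lemma chord_iter_orth k : orth n (chord_iter k) X.
Proof.
  induction k as [|k IH]; unfold orth in *.
  - apply Csum_zero; intros; cbn [chord_iter]; ring.
  - cbn [chord_iter]; rewrite inner_sub_l, IH.
    destruct (sol_spec (sys_eval n d f (vadd X (chord_iter k)))) as [E _].
    rewrite E; ring.
Qed.

Lemma Dsys_inj_X u v :
  orth n u X -> orth n v X ->
  (forall i, (i < n)%nat -> Dsys n d f X u i = Dsys n d f X v i) ->
  vnorm (S n) (vsub u v) = 0.
Proof.
  intros Hu Hv H; apply Rle_antisym; [|apply vnorm_ge0].
  eapply Rle_trans; [apply op_spec|].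
  - unfold orth in *; rewrite inner_sub_l, Hu, Hv; ring.
  - apply Req_le; unfold wnorm; rewrite vnorm_zero; [ring|].
    intros i Hi; rewrite Dsys_sub, H by easy; ring.
Qed.

Variables (w : Cvec) (T : R).
Let b := vnorm (S n) w.
Hypothesis w_newton : newton_corr n d f X w.
Hypothesis gT : g * T < 1.
Hypothesis T_ge0 : 0 <= T.
Hypothesis T_majorant : smale_majorant b g T <= T.

Lemma majseq_bounds k :
  0 <= majseq b g k /\ majseq b g k <= majseq b g (S k) /\ majseq b g (S k) <= T.
Proof. apply majseq_spec; try easy; [apply vnorm_ge0|apply g_ge0]. Qed.

(** [sol] is an arbitrary choice; injectivity of Df(X) on the complement identifies its value with
    the given Newton correction w. *)
Lemma chord_first_step j : (j < S n)%nat -> chord_iter 1 j = (- w j)%X.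
Proof.
  intros Hj; set (u := sol (sys_eval n d f (vadd X (chord_iter 0)))).
  change (chord_iter 1 j) with (C0 - u j)%X.
  destruct (sol_spec (sys_eval n d f (vadd X (chord_iter 0)))) as [Ho Hs].
  destruct w_newton as [Ho' Hs'].
  assert (E : vnorm (S n) (vsub u w) = 0).
  { apply Dsys_inj_X; [easy|easy|]; intros i Hi; unfold u.
    rewrite Hs, Hs' by easy; apply peval_ext; intros.
    unfold vadd; cbn [chord_iter]; ring. }
  pose proof (vnorm_eq0 _ _ E j Hj) as Ej; unfold vsub in Ej.
  replace (u j) with (w j + (u j - w j))%X by ring; rewrite Ej; ring.
Qed.

(** By construction Df(X)(v - v') = -f(X + v') for consecutive displacements v', v. Hence f(X + v)
    is the two-point remainder with derivative frozen at X, and one more correction is bounded by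
    the matching increment of the majorant. *)
Lemma chord_iter_step k :
  vnorm (S n) (chord_iter k) <= majseq b g k /\
  vnorm (S n) (vsub (chord_iter (S k)) (chord_iter k)) <=
    majseq b g (S k) - majseq b g k.
Proof.
  induction k as [|k [IH1 IH2]].
  - split.
    + rewrite vnorm_zero; [apply Rle_refl|easy].
    + rewrite vnorm_sub_sym, (vnorm_ext _ _ w).
      * cbn [majseq]; unfold smale_majorant; fold b; unfold Rdiv; lra.
      * intros j Hj; unfold vsub; rewrite chord_first_step by easy.
        cbn [chord_iter]; ring.
  - assert (IH1' : vnorm (S n) (chord_iter (S k)) <= majseq b g (S k))
      by (pose proof (vnorm_le_add_sub (S n) (chord_iter (S k)) (chord_iter k)); lra).
    split; [easy|].
    destruct (majseq_bounds k) as (M0 & M1 & M2).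
    set (v' := chord_iter k) in *; set (v := chord_iter (S k)) in *.
    set (u := sol (sys_eval n d f (vadd X v))).
    assert (Ev : forall j, vsub (chord_iter (S (S k))) v j = (- u j)%X).
    { intros j; change (vsub (vsub v u) v j = (- u j)%X); unfold vsub; ring. }
    destruct (sol_spec (sys_eval n d f (vadd X v))) as [Ho Hs]; fold u in Ho, Hs.
    destruct (sol_spec (sys_eval n d f (vadd X v'))) as [_ Hs'].
    apply Rle_trans with (vnorm (S n) u).
    { apply Req_le; rewrite vnorm_sub_sym; apply vnorm_ext; intros j _.
      specialize (Ev j); unfold vsub in *; replace (u j) with (- - u j)%X by ring.
      rewrite <- Ev; ring. }
    eapply Rle_trans; [now apply op_spec|].
    change (majseq b g (S (S k))) with (smale_majorant b g (majseq b g (S k))).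
    change (majseq b g (S k)) with (smale_majorant b g (majseq b g k)) at 2.
    assert (Ex : forall v, forall j, (j < S n)%nat -> vsub (vadd X v) X j = v j)
      by (intros; unfold vsub, vadd; ring).
    assert (Exx : forall j, (j < S n)%nat -> vsub (vadd X v) (vadd X v') j = vsub v v' j)
      by (intros; unfold vsub, vadd; ring).
    eapply Rle_trans; [|apply (taylor_majorized (vadd X v) (vadd X v'))].
    + apply Req_le; f_equal; apply wnorm_ext; intros i Hi.
      rewrite Hs by easy; unfold vsub at 1 2.
      rewrite (Dsys_ext n d f X _ _ i Exx).
      rewrite (Dsys_ext n d f X _ (vscal (- C1)%X (sol (sys_eval n d f (vadd X v'))))).
      * rewrite Dsys_scal, Hs' by easy; ring.
      * intros j _; change (vsub (vsub v' (sol (sys_eval n d f (vadd X v')))) v' j =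
          vscal (- C1)%X (sol (sys_eval n d f (vadd X v'))) j).
        unfold vsub, vscal; ring.
    + now rewrite (vnorm_ext _ _ _ (Ex v)).
    + now rewrite (vnorm_ext _ _ _ (Ex v')).
    + now rewrite (vnorm_ext _ _ _ Exx).
    + pose proof g_ge0; nra.
Qed.

Lemma zero_exists :
  exists a : Cvec, orth n a X /\ is_zero n d f (vadd X a) /\
    vnorm (S n) a <= T /\ vnorm (S n) (vadd a w) <= T - b.
Proof.
  assert (Hgrow : Un_growing (majseq b g)) by (intros k; apply majseq_bounds).
  assert (Hub : forall k, majseq b g k <= T).
  { intros k; destruct (majseq_bounds k); lra. }
  destruct (growing_cv (majseq b g) Hgrow) as (l & Hl).
  { exists T; intros r (k & ->); apply Hub. }
  assert (HlT : l <= T).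
  { apply (@Rle_cv_lim (majseq b g) (fun _ => T)); [easy|easy|].
    intros e He; exists O; intros; unfold R_dist; now rewrite Rminus_diag, Rabs_R0. }
  pose proof (fun k => growing_ineq _ l Hgrow Hl k) as Hkl.
  destruct (vector_limit (S n) chord_iter (majseq b g) l) as (a & Ha);
    [apply chord_iter_step|easy|].
  exists a; repeat split.
  - apply Cabs_eq0, Rle_antisym; [|apply Cabs_ge0].
    apply (le0_of_le_gap _ 1 (majseq b g) l); [lra|easy|]; intros k.
    replace (inner (S n) a X) with (inner (S n) (vsub a (chord_iter k)) X)
      by (rewrite inner_sub_l, (chord_iter_orth k : inner _ _ _ = C0); ring).
    eapply Rle_trans; [apply Cabs_inner_le|]; rewrite X_unit.
    specialize (Ha k); lra.
  - intros i Hi; apply Cabs_eq0, Rle_antisym; [|apply Cabs_ge0].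
    set (P := pnorm (S n) (d i) (f i)).
    assert (HP : 0 <= P) by apply pnorm_ge0.
    assert (Hl0 : 0 <= l) by (specialize (Hkl O); cbn in Hkl; lra).
    pose proof (pos_INR (d i)) as Hdi.
    assert (HK : 0 <= (1 + l) ^ (d i - 1)) by (apply pow_le; lra).
    apply (le0_of_le_gap _ (P * (INR (d i) * 1 ^ (d i - 1) + INR (d i) * (1 + l) ^ (d i - 1)))
      (majseq b g) l); [|easy|].
    { rewrite pow1; apply Rmult_le_pos; [easy|].
      apply Rplus_le_le_0_compat; [lra|now apply Rmult_le_pos]. }
    intros k; set (v := chord_iter k).
    destruct (sol_spec (sys_eval n d f (vadd X v))) as [_ Hs]; specialize (Hs i Hi).
    destruct (chord_iter_step k) as [Hv1 Hv2]; specialize (Ha k); specialize (Hkl k) as Hk1.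
    fold v in Hv1, Hv2, Ha; specialize (Hkl (S k)).
    set (u := sol (sys_eval n d f (vadd X v))) in *.
    assert (Hu : vnorm (S n) u <= l - majseq b g k).
    { apply Rle_trans with (majseq b g (S k) - majseq b g k); [|lra].
      eapply Rle_trans; [|apply Hv2]; rewrite vnorm_sub_sym.
      apply Req_le, vnorm_ext; intros j _.
      change (u j = vsub v (vsub v u) j); unfold vsub; ring. }
    (* f(X + v) = Df(X) u with u the next correction, so both summands are bounded by a multiple of
       l - t_k and the value at the limit vanishes. *)
    replace (sys_eval n d f (vadd X a) i) with
      (Dsys n d f X u i + (sys_eval n d f (vadd X a) i - sys_eval n d f (vadd X v) i))%X
      by (rewrite Hs; ring).
    eapply Rle_trans; [apply Cabs_triangle|].
    rewrite Rmult_plus_distr_l, Rmult_plus_distr_r; apply Rplus_le_compat.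
    + eapply Rle_trans; [apply pdiff_bound with (s := 1); lra|].
      fold P; rewrite !Rmult_assoc; apply Rmult_le_compat_l; [easy|].
      apply Rmult_le_compat_l; [easy|]; apply Rmult_le_compat_l; [rewrite pow1; lra|easy].
    + assert (Ha1 : vnorm (S n) a <= l)
        by (pose proof (vnorm_le_add_sub (S n) a v); lra).
      pose proof (majseq_bounds k) as [Hm0 _].
      eapply Rle_trans; [apply peval_lipschitz with (s := 1 + l) (s' := 1 + majseq b g k)|].
      * pose proof (vnorm_triangle (S n) X a); lra.
      * pose proof (vnorm_triangle (S n) X v); lra.
      * rewrite (vnorm_ext _ _ (vsub a v)); [lra|intros; unfold vsub, vadd; ring].
      * fold P; rewrite Rmult_assoc; apply Rmult_le_compat_l; [easy|].
        eapply Rle_trans; [apply pow_sub_le; lra|]; apply Req_le; ring.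
  - pose proof (Ha O) as H0; cbn [majseq] in H0.
    rewrite (vnorm_ext _ _ a) in H0; [lra|].
    intros; unfold vsub; cbn [chord_iter]; ring.
  - pose proof (Ha 1%nat) as H1.
    (* The first term of the majorizing sequence is b, so the distance from the Newton point to the
       zero is at most T - b. *)
    replace (majseq b g 1) with b in H1
      by (cbn [majseq]; unfold smale_majorant, Rdiv; ring).
    rewrite (vnorm_ext _ _ (vadd a w)) in H1; [lra|].
    intros j Hj; unfold vsub, vadd; rewrite chord_first_step by easy; ring.
Qed.

End UnitPoint.

(** * Normalization of the base point *)

Lemma Dmax_ge n d i : (i < n)%nat -> (d i <= Dmax n d)%nat.
Proof.
  intros Hi; unfold Dmax; assert (Hin : In i (seq 0 n)) by (apply in_seq; lia).
  induction (seq 0 n) as [|k l IH]; [easy|]; cbn.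
  destruct Hin as [->|Hin]; [lia|]; specialize (IH Hin); lia.
Qed.

(** A component of degree 0 has zero differential, so Df(x) could not reach a vector with nonzero
    i-th entry. *)
Lemma rank_full_degree n d f x i : rank_full n d f x -> (i < n)%nat -> (1 <= d i)%nat.
Proof.
  intros Hrk Hi; destruct (d i) as [|k] eqn:E; [exfalso|lia].
  destruct (Hrk (fun _ => C1)) as (w & _ & Hw); specialize (Hw i Hi).
  rewrite Dsys_pdiff, E, pdiff_0 in Hw; injection Hw; lra.
Qed.

Lemma Cpow_RtoC r k : Cpow (RtoC r) k = RtoC (r ^ k).
Proof.
  induction k as [|k IH]; [easy|]; cbn [Cpow pow]; now rewrite IH, RtoC_mul.
Qed.

Lemma opnorm_lub_ge0 n d f x op : is_lub (opnorm_set n d f x) op -> 0 <= op.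
Proof.
  intros [Hub _]; apply Hub.
  exists (fun _ => C0), (fun _ => C0); repeat split.
  - rewrite vnorm_zero; [lra|easy].
  - apply Csum_zero; intros; ring.
  - intros i Hi; unfold diag_scale; transitivity C0; [|ring].
    apply Csum_zero; intros; ring.
  - symmetry; now apply vnorm_zero.
Qed.

Section Normalization.

Variables (n : nat) (d : nat -> nat) (f : system) (x : Cvec) (op : R).
Let r := vnorm (S n) x.
Let X := vscal (RtoC (/ r)) x.

Hypothesis r_gt0 : 0 < r.
Hypothesis x_rank : rank_full n d f x.
Hypothesis op_lub : is_lub (opnorm_set n d f x) op.

Lemma unit_norm : vnorm (S n) X = 1.
Proof.
  unfold X; rewrite vnorm_scal, Cabs_RtoC, Rabs_pos_eq
    by (apply Rlt_le, Rinv_0_lt_compat; easy).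
  fold r; apply Rinv_l; lra.
Qed.

Lemma x_unit_scal j : x j = vscal (RtoC r) X j.
Proof.
  unfold X, vscal; transitivity ((RtoC r * RtoC (/ r)) * x j)%X; [|ring].
  rewrite <- RtoC_mul, Rinv_r by lra; change (RtoC 1) with C1; ring.
Qed.

Lemma orth_unit v : orth n v X <-> orth n v x.
Proof.
  unfold orth; split; intros H.
  - rewrite (inner_ext _ v x v (vscal (RtoC r) X)) by (try easy; intros; apply x_unit_scal).
    rewrite inner_scal_r, H; ring.
  - unfold X; rewrite inner_scal_r, H; ring.
Qed.

Lemma Dsys_unit v i :
  Dsys n d f X v i = (RtoC (/ r ^ (d i - 1)) * Dsys n d f x v i)%X.
Proof. unfold X; now rewrite Dsys_scal_base, Cpow_RtoC, pow_inv. Qed.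

Lemma rank_full_unit : rank_full n d f X.
Proof.
  intros v; destruct (x_rank (fun i => RtoC (r ^ (d i - 1)) * v i)%X) as (w & Ho & Hw).
  exists w; split; [now apply orth_unit|]; intros i Hi.
  rewrite Dsys_unit, Hw by easy.
  transitivity ((RtoC (/ r ^ (d i - 1)) * RtoC (r ^ (d i - 1))) * v i)%X; [ring|].
  rewrite <- RtoC_mul, Rinv_l by (apply pow_nonzero; lra); change (RtoC 1) with C1; ring.
Qed.

(** The factor |x|^(d_i - 1) in the definition of mu cancels the homogeneity of Df, so the norm
    taken at x serves at X. Testing the supremum on multiples of v turns it into a lower bound for
    Df(X). *)
Lemma opnorm_unit v :
  orth n v X -> vnorm (S n) v <= op * wnorm n d (Dsys n d f X v).
Proof.
  intros Hv; pose proof (opnorm_lub_ge0 _ _ _ _ _ op_lub) as Hop0.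
  set (k := wnorm n d (Dsys n d f X v)); assert (Hk : 0 <= k) by apply vnorm_ge0.
  assert (Hs : forall s, 0 < s -> s * k <= 1 -> s * vnorm (S n) v <= op).
  { intros s Hs Hsk; apply op_lub.
    exists (vscal (RtoC s) (fun i => RtoC (/ sqrt (INR (d i))) * Dsys n d f X v i)%X),
      (vscal (RtoC s) v); split; [|split; [split|]].
    - rewrite vnorm_scal, Cabs_RtoC, Rabs_pos_eq by lra; easy.
    - unfold orth; rewrite inner_scal_l, (proj1 (orth_unit v) Hv); ring.
    - intros i Hi; rewrite Dsys_scal; unfold diag_scale, vscal; rewrite Dsys_unit; fold r.
      pose proof (rank_full_degree n d f x i x_rank Hi).
      assert (0 < sqrt (INR (d i))) by (apply sqrt_lt_R0, lt_0_INR; lia).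
      transitivity (RtoC s * ((RtoC (sqrt (INR (d i)) * r ^ (d i - 1)) *
        RtoC (/ sqrt (INR (d i))) * RtoC (/ r ^ (d i - 1))) * Dsys n d f x v i))%X; [|ring].
      rewrite <- !RtoC_mul.
      replace (_ * _ * _ * _) with 1 by (field; split; [apply pow_nonzero; lra|lra]).
      change (RtoC 1) with C1; ring.
    - rewrite vnorm_scal, Cabs_RtoC, Rabs_pos_eq by lra; easy. }
  pose proof (vnorm_ge0 (S n) v).
  destruct Hk as [Hk|Hk].
  - specialize (Hs (/ k) (Rinv_0_lt_compat _ Hk) ltac:(rewrite Rinv_l; lra)).
    apply Rmult_le_reg_l with (/ k); [now apply Rinv_0_lt_compat|].
    replace (/ k * (op * k)) with op by (field; lra); easy.
  - rewrite <- Hk in *; rewrite Rmult_0_r.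
    destruct H as [H|H]; [|lra].
    (* If Df(X) v were zero with v nonzero, multiples of v would reach norm op + 1 and exceed the
       supremum. *)
    specialize (Hs ((op + 1) / vnorm (S n) v) ltac:(apply Rdiv_lt_0_compat; lra) ltac:(lra)).
    replace (_ / _ * _) with (op + 1) in Hs by (field; lra); lra.
Qed.

(** Chaining the lower bound by [op] with the upper bound of Df(X) by the Bombieri norm gives |w| <=
    op |f| sqrt D |w| for a preimage w of (1, ..., 1), which is nonzero as n >= 1. *)
Lemma condition_ge1 :
  (1 <= n)%nat -> 1 <= BWnorm n d f * op * sqrt (INR (Dmax n d)).
Proof.
  intros Hn; destruct (rank_full_unit (fun _ => C1)) as (w & Ho & Hw).
  pose proof (opnorm_unit w Ho) as H1.
  pose proof (opnorm_lub_ge0 _ _ _ _ _ op_lub) as Hop0.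
  pose proof (sqrt_pos (INR (Dmax n d))).
  assert (Hw0 : 0 < vnorm (S n) w).
  { pose proof (vnorm_ge0 (S n) w) as [|E]; [easy|exfalso].
    pose proof (vnorm_eq0 _ _ (eq_sym E)) as E0; specialize (Hw O ltac:(lia)).
    unfold Dsys in Hw; rewrite Csum_zero in Hw by (intros; rewrite E0 by easy; ring).
    injection Hw; lra. }
  assert (H2 : wnorm n d (Dsys n d f X w) <=
    BWnorm n d f * (sqrt (INR (Dmax n d)) * vnorm (S n) w)).
  { apply wnorm_bound.
    - intros i Hi; now apply (rank_full_degree n d f x).
    - apply Rmult_le_pos; lra.
    - intros i Hi; rewrite Dsys_pdiff.
      eapply Rle_trans; [apply pdiff_bound with (s := 1); rewrite unit_norm; lra|].
      apply Rmult_le_compat_l; [apply pnorm_ge0|]; rewrite pow1, Rmult_1_r.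
      rewrite <- (sqrt_sqrt (INR (d i))) at 1 by apply pos_INR.
      rewrite !Rmult_assoc; apply Rmult_le_compat_l; [apply sqrt_pos|].
      apply Rmult_le_compat_r; [lra|].
      apply sqrt_le_1_alt, le_INR, Dmax_ge; easy. }
  assert (H3 : op * wnorm n d (Dsys n d f X w) <=
    op * (BWnorm n d f * (sqrt (INR (Dmax n d)) * vnorm (S n) w)))
    by (now apply Rmult_le_compat_l).
  apply Rmult_le_reg_r with (vnorm (S n) w); [easy|]; lra.
Qed.

Lemma newton_corr_unit w :
  newton_corr n d f x w ->
  newton_corr n d f X (vscal (RtoC (/ r)) w) /\
  vnorm (S n) (vscal (RtoC (/ r)) w) = beta0 n x w.
Proof.
  intros [Ho Hw]; split; [split|].
  - apply orth_unit; unfold orth in *; rewrite inner_scal_l, Ho; ring.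
  - intros i Hi; rewrite Dsys_scal; unfold X.
    rewrite Dsys_scal_base, sys_eval_scal, Hw by easy.
    pose proof (rank_full_degree n d f x i x_rank Hi).
    replace (d i) with (S (d i - 1)) at 2 by lia; cbn [Cpow]; ring.
  - rewrite vnorm_scal, Cabs_RtoC, Rabs_pos_eq by (apply Rlt_le, Rinv_0_lt_compat; easy).
    unfold beta0; fold r; field; lra.
Qed.

End Normalization.

(** * Return to the original point and proof of the estimates *)

Lemma tan_dR_unit_chart n X a :
  vnorm (S n) X = 1 -> orth n a X ->
  dR n X (vadd X a) < PI / 2 /\ tan (dR n X (vadd X a)) = vnorm (S n) a.
Proof.
  (* In the chart <X + a, X> = 1 and |X + a|^2 = 1 + |a|^2, so the tangent is exactly |a|. *)
  intros HX Ha; assert (Ei : inner (S n) (vadd X a) X = C1).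
  { rewrite inner_add_l, inner_self, HX, (Ha : inner _ _ _ = C0), Rmult_1_r.
    change (RtoC 1) with C1; ring. }
  assert (Ep : Cabs (inner (S n) X (vadd X a)) = 1)
    by (rewrite Cabs_inner_sym, Ei; apply Cabs_C1).
  destruct (tan_dR n X (vadd X a) ltac:(lra)) as (H1 & H2 & H3).
  split; [easy|]; rewrite Ep, HX, vnorm_add_sqr, HX, inner_conj, (Ha : inner _ _ _ = C0) in H3.
  unfold Cconj, C0 in H3; cbn [fst snd] in H3.
  pose proof (vnorm_ge0 (S n) a).
  apply Rle_antisym; apply le_of_sqr_le; lra.
Qed.

Theorem theorem3 :
  forall (n : nat) (d : nat -> nat) (f : system) (x : Cvec) (alpha : R),
    (2 <= n)%nat ->
    (2 <= Dmax n d)%nat ->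
    0 < alpha -> alpha <= alpha0 ->
    sys_nonzero n d f ->
    vnonzero (S n) x ->
    rank_full n d f x ->
    forall (mu : R) (w : Cvec),
      is_mu n d f x mu ->
      newton_corr n d f x w ->
      INR (Dmax n d) * sqrt (INR (Dmax n d)) / 2 * mu * beta0 n x w <= alpha ->
      forall y : Cvec, (forall j, (j <= n)%nat -> y j = Csub (x j) (w j)) ->
      exists zeta : Cvec,
        vnonzero (S n) zeta /\ is_zero n d f zeta /\
        dT_le n x zeta (sigma_alpha alpha * beta0 n x w) /\
        dR n y zeta <= (sigma_alpha alpha - 1) * beta0 n x w /\
        (alpha <= 49 / 1000 -> approx_zero n d f x zeta /\ approx_zero n d f y zeta).
Proof.
  intros n d f x alpha Hn HD Ha0 Ha1 _ Hx Hrk mu w (op & Hop & ->) Hw Hmu y Hy.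
  pose proof alpha0_le.
  destruct (sigma_alpha_spec alpha Ha0 ltac:(lra)) as ((Hs1 & Hs2) & Has & _).
  pose proof (vnorm_gt0 _ _ Hx) as Hr.
  set (r := vnorm (S n) x) in *; set (X := vscal (RtoC (/ r)) x).
  set (D := Dmax n d) in *; set (s := sigma_alpha alpha) in *.
  pose proof (unit_norm n x Hr) as HX.
  pose proof (condition_ge1 n d f x op Hr Hrk Hop ltac:(lia)) as HM.
  destruct (newton_corr_unit n d f x Hr Hrk w Hw) as [Hw' Eb].
  fold r X in HX, Hw', Eb; fold D in HM; set (w' := vscal (RtoC (/ r)) w) in *.
  set (b := beta0 n x w) in *; set (g := INR D * (BWnorm n d f * op * sqrt (INR D)) / 2).
  assert (Hd : forall i, (i < n)%nat -> (1 <= d i <= D)%nat).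
  { intros i Hi; split; [now apply (rank_full_degree n d f x)|now apply Dmax_ge]. }
  assert (Hop0 : 0 < op).
  { destruct (opnorm_lub_ge0 _ _ _ _ _ Hop) as [|E]; [easy|].
    rewrite <- E in HM; lra. }
  assert (Hopx : forall v, orth n v X -> vnorm (S n) v <= op * wnorm n d (Dsys n d f X v))
    by (intros v; now apply opnorm_unit).
  assert (Hb : 0 <= b) by (rewrite <- Eb; apply vnorm_ge0).
  assert (Hgb : g * b <= alpha) by (unfold g; lra).
  assert (Hg : 1 <= g) by (unfold g; apply (le_INR 2) in HD; cbn in HD; nra).
  assert (Hgs : g * (s * b) <= alpha * s) by nra.
  destruct (zero_exists n d f X op D HX Hd Hop0 Hopx HM (rank_full_unit n d f x Hr Hrk)
    w' (s * b)) as (a & Ao & Az & An & Aw).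
  { easy. }
  { fold g; lra. }
  { apply Rmult_le_pos; lra. }
  { fold g; rewrite Eb; apply majorant_sigma; lra. }
  set (zeta := vadd X a) in *.
  destruct (tan_dR_unit_chart n X a HX Ao) as [T1 T2]; fold zeta in T1, T2.
  assert (Hzn : 1 <= vnorm (S n) zeta).
  { pose proof (Cabs_inner_le (S n) zeta X) as HC; unfold zeta in HC at 1.
    rewrite inner_add_l, inner_self, HX, (Ao : inner _ _ _ = C0) in HC.
    rewrite Rmult_1_r in HC; change (RtoC 1) with C1 in HC.
    replace (C1 + C0)%X with C1 in HC by ring; rewrite Cabs_C1 in HC; lra. }
  assert (Hr0 : RtoC r <> C0) by (intros [=]; lra).
  assert (Ex : dR n zeta x = dR n X zeta).
  { rewrite (dR_ext n zeta x zeta (vscal (RtoC r) X))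
      by (try easy; intros; now apply x_unit_scal).
    rewrite dR_scal_r by (try easy; lra); apply dR_sym. }
  exists zeta; split; [apply vnonzero_of_vnorm; lra|split; [easy|split; [|split]]].
  - unfold dT_le; rewrite (dR_sym n x zeta), Ex; split; [easy|]; now rewrite T2.
  - set (y' := vsub X w').
    assert (Ey : forall j, (j < S n)%nat -> y j = vscal (RtoC r) y' j).
    { intros j Hj; rewrite Hy by lia.
      unfold y', w', X, vsub, vscal.
      transitivity ((RtoC r * RtoC (/ r)) * (x j - w j))%X; [|ring].
      rewrite <- RtoC_mul, Rinv_r by lra; change (RtoC 1) with C1; ring. }
    assert (Hy' : vnorm (S n) y' * vnorm (S n) y' = 1 + b * b).
    { rewrite <- Eb, (vnorm_ext _ y' (vadd X (vscal (- C1)%X w')))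
        by (intros; unfold y', vsub, vadd, vscal; ring).
      rewrite vnorm_add_sqr, inner_scal_r, inner_conj.
      rewrite (proj1 Hw' : inner _ _ _ = C0), vnorm_scal, Cabs_opp, Cabs_C1, HX.
      unfold Cmul, Cconj, Copp, C0, C1; cbn [fst snd]; ring. }
    (* From g >= 1 and g b <= alpha <= 1/6. *)
    assert (Hb1 : b <= 1) by nra.
    assert (0 < vnorm (S n) y') by (pose proof (vnorm_ge0 (S n) y'); nra).
    rewrite dR_sym, (dR_ext n zeta y zeta (vscal (RtoC r) y')) by easy.
    rewrite dR_scal_r, dR_sym by (try easy; lra).
    (* Here e = (s - 1) b, and e <= b because sigma <= 2. *)
    apply dR_le_chart with b; [lra|easy| |nra|easy].
    rewrite vnorm_sub_sym, (vnorm_ext _ _ (vadd a w'))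
      by (intros; unfold zeta, y', vsub, vadd; ring).
    rewrite Eb in Aw; lra.
  - intros Ha2; pose proof (alpha_sigma_small alpha Ha0 Ha2) as Has2; fold s in Has2.
    assert (Hga : g * vnorm (S n) a <= 52 / 1000) by nra.
    (* x itself lies at tangent distance exactly |a| from zeta, so the one-step estimate applies to
       it and locates y. *)
    destruct (newton_one_step n d f X op D HX Hd Hop0 Hopx HM a HD Ao Az Hga x Hx)
      as [_ Hstep].
    { fold zeta; rewrite Ex; easy. }
    { fold zeta; rewrite Ex, T2; lra. }
    destruct (Hstep w y Hw Hy) as (Y1 & Y2 & Y3 & Y4).
    fold zeta in Y2, Y3, Y4; fold g in Y4; rewrite Ex, T2 in Y4.
    split; apply (approx_zero_near n d f X op D HX Hd Hop0 Hopx HM a HD Ao Az Hga);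
      fold zeta; try easy.
    + rewrite Ex; easy.
    + rewrite Ex, T2; lra.
    (* 4 g |a|^2 <= 0.208 |a|, so y is no farther from zeta than x. *)
    + pose proof (vnorm_ge0 (S n) a); nra.
Qed.
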